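(* The 2-category $\mathbf{Sup}_{\mathrm{hil}}$ of Hilbert lattices is 2-z-exact with a strong bizero object, its normal 2-monomorphisms and its normal 2-epimorphisms are closed under composition, and it satisfies condition (DPN); but it is not 2-di-exact. Moreover the Snake Lemma holds in $\mathbf{Sup}_{\mathrm{hil}}$: for all 1-cells $$A\xrightarrow{a}B\xrightarrow{b}C\to 0,\qquad 0\to X\xrightarrow{c}Y\xrightarrow{d}Z,\qquad f\colon A\to X,\ g\colon B\to Y,\ h\colon C\to Z$$ of $\mathbf{Sup}_{\mathrm{hil}}$ with $g\circ a\cong c\circ f$ and $h\circ b\cong d\circ g$, with both rows 2-exact and with $f,g,h$ normal, there is a 1-cell $\partial\colon\mathrm{Ker}(h)\to\mathrm{Cok}(f)$ such that the sequence $$\mathrm{Ker}(f)\xrightarrow{\bar a}\mathrm{Ker}(g)\xrightarrow{\bar b}\mathrm{Ker}(h)\xrightarrow{\partial}\mathrm{Cok}(f)\xrightarrow{\underline c}\mathrm{Cok}(g)\xrightarrow{\underline d}\mathrm{Cok}(h)$$ is 2-exact, where $\bar a,\bar b,\underline c,\underline d$ are induced by $a,b,c,d$ on 2-kernels and 2-cokernels; and if $a$ is a 2-kernel of $b$ then $\bar a$ is a 2-kernel of $\bar b$, and dually if $d$ is a 2-cokernel of $c$ then $\underline d$ is a 2-cokernel of $\underline c$.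
   Context: $\mathbf{Sup}$ is the 2-category whose objects are the complete lattices (small with respect to a fixed Grothendieck universe), whose 1-cells are the maps preserving all joins (including the empty one), and in which there is exactly one 2-cell $f\Rightarrow g$ when $f\le g$ pointwise and none otherwise. For a complex Hilbert space $H$ (of arbitrary, possibly infinite, dimension), $\mathrm L(H)$ is the complete lattice of closed subspaces of $H$ ordered by inclusion. $\mathbf{Sup}_{\mathrm{hil}}$ is the full sub-2-category of $\mathbf{Sup}$ on the complete lattices isomorphic to some $\mathrm L(H)$. A bizero object of a 2-category $\mathcal L$ is an object $0$ such that for every object $A$ the hom-categories $\mathcal L(A,0)$ and $\mathcal L(0,A)$ are equivalent to the terminal category. A 1-cell is null if it factors through $0$; $f\cong 0$ means that $f$ is isomorphic (via an invertible 2-cell) to a null 1-cell. The bizero object is strong if between any two parallel 1-cells that factor through $0$ there is exactly one 2-cell. In a 2-category with a strong bizero object, a 2-kernel of $f\colon A\to B$ is a 1-cell $k\colon K\to A$ with an invertible 2-cell $f\circ k\cong 0$ such that (1) for every $z\colon Z\to A$ with $f\circ z\cong0$ there is $u\colon Z\to K$ with $k\circ u\cong z$; (2) for all $u,v\colon Z\to K$ and every 2-cell $\lambda\colon k\circ u\Rightarrow k\circ v$ there is a unique 2-cell $\mu\colon u\Rightarrow v$ whose whiskering with $k$ is $\lambda$. 2-cokernels are defined dually. They are written $\ker(f)\colon\mathrm{Ker}(f)\to A$ and $\operatorname{coker}(f)\colon B\to\mathrm{Cok}(f)$. A 2-z-exact 2-category is one with a strong bizero object and all 2-kernels and 2-cokernels.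 A normal 2-monomorphism (normal 2-epimorphism) is a 1-cell which is a 2-kernel (2-cokernel) of some 1-cell. A 1-cell is normal if it is isomorphic to $m\circ e$ with $e$ a normal 2-epimorphism and $m$ a normal 2-monomorphism; this factorisation is unique up to equivalence and one writes $m=\mathrm{im}(f)$. A 1-cell is antinormal if it is isomorphic to $e\circ m$ with $m$ a normal 2-monomorphism and $e$ a normal 2-epimorphism. A 2-category is 2-di-exact if it is 2-z-exact and every antinormal 1-cell is normal. (DPN): for every normal 2-monomorphism $m\colon K\to X$ and normal 2-epimorphism $e\colon X\to R$, the composite $e\circ m$ is normal if and only if the dinversion $\operatorname{coker}(m)\circ\ker(e)\colon\mathrm{Ker}(e)\to\mathrm{Cok}(m)$ is normal. A composable pair $(f,g)$ of normal 1-cells is 2-exact at the middle object if $\mathrm{im}(f)$ is a 2-kernel of $g$. A sequence is 2-exact if all its 1-cells are normal and it is 2-exact at every object having both an incoming and an outgoing 1-cell. The induced 1-cells satisfy $\ker(g)\bar a\cong a\ker(f)$, $\ker(h)\bar b\cong b\ker(g)$, $\underline c\operatorname{coker}(f)\cong\operatorname{coker}(g)c$, $\underline d\operatorname{coker}(g)\cong\operatorname{coker}(h)d$. *)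

(* Defs.v *)
From HB Require Import structures.
From mathcomp Require Import all_boot all_order all_algebra complex.
From mathcomp Require Import boolp classical_sets reals topology normedtype.

Set Implicit Arguments.
Unset Strict Implicit.
Unset Printing Implicit Defensive.

Import Order.TTheory GRing.Theory Num.Theory.
Import numFieldNormedType.Exports.

Local Open Scope classical_set_scope.
Local Open Scope ring_scope.
Local Open Scope complex_scope.

Record category := Category {
  cat_ob :> Type;
  chom : cat_ob -> cat_ob -> Type;
  cid : forall x, chom x x;
  ccomp : forall x y z, chom y z -> chom x y -> chom x z;
  ccompA : forall x y z t (h : chom z t) (g : chom y z) (f : chom x y),
    ccomp h (ccomp g f) = ccomp (ccomp h g) f;
  ccomp1c : forall x y (f : chom x y), ccomp (cid y) f = f;
  ccompc1 : forall x y (f : chom x y), ccomp f (cid x) = f }.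

Arguments cid {c} x.

Definition invertible (C : category) (x y : C) (f : chom x y) : Prop :=
  exists g : chom y x, ccomp g f = cid x /\ ccomp f g = cid y.

Record functor (C D : category) := Functor {
  fobj :> C -> D;
  fmap : forall x y, chom x y -> chom (fobj x) (fobj y);
  fmap_id : forall x, fmap (cid x) = cid (fobj x);
  fmap_comp : forall x y z (g : chom y z) (f : chom x y),
    fmap (ccomp g f) = ccomp (fmap g) (fmap f) }.

Program Definition functor_id (C : category) : functor C C :=
  @Functor C C id (fun x y f => f) _ _.
Next Obligation. by []. Qed.
Next Obligation. by []. Qed.

Program Definition functor_comp (C D E : category)
    (G : functor D E) (F : functor C D) : functor C E :=
  @Functor C E (fun x => G (F x)) (fun x y f => fmap G (fmap F f)) _ _.
Next Obligation. by move=> C D E G F x /=; rewrite !fmap_id. Qed.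
Next Obligation. by move=> C D E G F x y z g f /=; rewrite !fmap_comp. Qed.

Definition nat_iso (C D : category) (F G : functor C D) : Prop :=
  exists eta : forall x, chom (F x) (G x),
    (forall x y (f : chom x y),
      ccomp (eta y) (fmap F f) = ccomp (fmap G f) (eta x)) /\
    (forall x, invertible (eta x)).

Definition cat_equivalent (C D : category) : Prop :=
  exists (F : functor C D) (G : functor D C),
    nat_iso (functor_comp G F) (functor_id C) /\
    nat_iso (functor_comp F G) (functor_id D).

Program Definition terminal_category : category :=
  @Category unit (fun _ _ => unit) (fun _ => tt) (fun _ _ _ _ _ => tt) _ _ _.
Next Obligation. by []. Qed.
Next Obligation. by move=> x y []. Qed.
Next Obligation. by move=> x y []. Qed.

(* Transport of a 2-cell along equalities of its source and target; needed
   because the unit and associativity laws of 1-cells are mere equalities. *)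
Definition chom_cast (C : category) (x x' y y' : C) (ex : x = x') (ey : y = y')
    (f : chom x y) : chom x' y' :=
  match ex in _ = x0, ey in _ = y0 return chom x0 y0 with
  | erefl, erefl => f
  end.

(* The 2-cells f => g are the morphisms [chom f g] of the hom-category, with
   [ccomp] as vertical composition; [comp1 g f] is "g after f". *)
Record two_category := TwoCategory {
  ob2 :> Type;
  hom1 : ob2 -> ob2 -> category;
  id1 : forall A, hom1 A A;
  comp1 : forall A B C, hom1 B C -> hom1 A B -> hom1 A C;
  hcomp : forall A B C (g g' : hom1 B C) (f f' : hom1 A B),
    chom g g' -> chom f f' -> chom (comp1 g f) (comp1 g' f');
  hcomp_id : forall A B C (g : hom1 B C) (f : hom1 A B),
    hcomp (cid g) (cid f) = cid (comp1 g f);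
  interchange : forall A B C (g g' g'' : hom1 B C) (f f' f'' : hom1 A B)
      (b' : chom g' g'') (b : chom g g') (a' : chom f' f'') (a : chom f f'),
    hcomp (ccomp b' b) (ccomp a' a) = ccomp (hcomp b' a') (hcomp b a);
  comp1A : forall A B C D (h : hom1 C D) (g : hom1 B C) (f : hom1 A B),
    comp1 h (comp1 g f) = comp1 (comp1 h g) f;
  comp1_1f : forall A B (f : hom1 A B), comp1 (id1 B) f = f;
  comp1_f1 : forall A B (f : hom1 A B), comp1 f (id1 A) = f;
  hcompA : forall A B C D (h h' : hom1 C D) (g g' : hom1 B C) (f f' : hom1 A B)
      (c : chom h h') (b : chom g g') (a : chom f f'),
    chom_cast (comp1A h g f) (comp1A h' g' f') (hcomp c (hcomp b a)) =
    hcomp (hcomp c b) a;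
  hcomp_1f : forall A B (f f' : hom1 A B) (a : chom f f'),
    chom_cast (comp1_1f f) (comp1_1f f') (hcomp (cid (id1 B)) a) = a;
  hcomp_f1 : forall A B (f f' : hom1 A B) (a : chom f f'),
    chom_cast (comp1_f1 f) (comp1_f1 f') (hcomp a (cid (id1 A))) = a }.

Arguments hom1 {t} A B.
Arguments id1 {t} A.

Declare Scope two_cat_scope.
Delimit Scope two_cat_scope with two.

Notation "g ∘ f" := (comp1 g f)
  (at level 40, left associativity) : two_cat_scope.

Definition iso1 (L : two_category) (A B : L) (f g : hom1 A B) : Prop :=
  exists a : chom f g, invertible a.

Notation "f ≅ g" := (iso1 f g) (at level 70) : two_cat_scope.

Local Open Scope two_cat_scope.

Definition full_sub (L : two_category) (P : L -> Prop) : two_category :=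
  @TwoCategory {A : L | P A}
    (fun A B => hom1 (sval A) (sval B))
    (fun A => id1 (sval A))
    (fun A B C g f => g ∘ f)
    (fun A B C g g' f f' b a => hcomp b a)
    (fun A B C => @hcomp_id L (sval A) (sval B) (sval C))
    (fun A B C => @interchange L (sval A) (sval B) (sval C))
    (fun A B C D => @comp1A L (sval A) (sval B) (sval C) (sval D))
    (fun A B => @comp1_1f L (sval A) (sval B))
    (fun A B => @comp1_f1 L (sval A) (sval B))
    (fun A B C D => @hcompA L (sval A) (sval B) (sval C) (sval D))
    (fun A B => @hcomp_1f L (sval A) (sval B))
    (fun A B => @hcomp_f1 L (sval A) (sval B)).

Section TwoExactness.
Variable L : two_category.
Implicit Types A B C O : L.

Definition is_bizero O : Prop := forall A,
  cat_equivalent (hom1 A O) terminal_category /\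
  cat_equivalent (hom1 O A) terminal_category.

Definition null1 O A B (f : hom1 A B) : Prop :=
  exists (t : hom1 A O) (s : hom1 O B), f = s ∘ t.

Definition is_strong_bizero O : Prop :=
  is_bizero O /\
  forall A B (f g : hom1 A B), null1 O f -> null1 O g ->
    exists! a : chom f g, True.

Definition iso_zero O A B (f : hom1 A B) : Prop :=
  exists2 z : hom1 A B, null1 O z & f ≅ z.

Definition is_2kernel O A B (f : hom1 A B) K (k : hom1 K A) : Prop :=
  [/\ iso_zero O (f ∘ k),
      forall Z (z : hom1 Z A), iso_zero O (f ∘ z) ->
        exists u : hom1 Z K, k ∘ u ≅ z
    & forall Z (u v : hom1 Z K) (l : chom (k ∘ u) (k ∘ v)),
        exists! m : chom u v, hcomp (cid k) m = l].

Definition is_2cokernel O A B (f : hom1 A B) Q (q : hom1 B Q) : Prop :=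
  [/\ iso_zero O (q ∘ f),
      forall Z (z : hom1 B Z), iso_zero O (z ∘ f) ->
        exists u : hom1 Q Z, u ∘ q ≅ z
    & forall Z (u v : hom1 Q Z) (l : chom (u ∘ q) (v ∘ q)),
        exists! m : chom u v, hcomp m (cid q) = l].

Definition is_2z_exact O : Prop :=
  [/\ is_strong_bizero O,
      forall A B (f : hom1 A B), exists K (k : hom1 K A), is_2kernel O f k
    & forall A B (f : hom1 A B), exists Q (q : hom1 B Q), is_2cokernel O f q].

Definition normal_2mono O K A (k : hom1 K A) : Prop :=
  exists B (f : hom1 A B), is_2kernel O f k.

Definition normal_2epi O B Q (q : hom1 B Q) : Prop :=
  exists A (f : hom1 A B), is_2cokernel O f q.

(* [m] is the mono part of a normal factorisation of [f], that is im(f). *)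
Definition is_image O A B (f : hom1 A B) I (m : hom1 I B) : Prop :=
  normal_2mono O m /\ exists2 e : hom1 A I, normal_2epi O e & f ≅ m ∘ e.

Definition normal1 O A B (f : hom1 A B) : Prop :=
  exists I (m : hom1 I B), is_image O f m.

Definition antinormal1 O A B (f : hom1 A B) : Prop :=
  exists I (m : hom1 A I) (e : hom1 I B),
    [/\ normal_2mono O m, normal_2epi O e & f ≅ e ∘ m].

Definition is_2di_exact O : Prop :=
  is_2z_exact O /\
  forall A B (f : hom1 A B), antinormal1 O f -> normal1 O f.

Definition DPN O : Prop :=
  forall K X R (m : hom1 K X) (e : hom1 X R),
    normal_2mono O m -> normal_2epi O e ->
    forall Ke (k : hom1 Ke X) Cm (q : hom1 X Cm),
      is_2kernel O e k -> is_2cokernel O m q ->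
      (normal1 O (e ∘ m) <-> normal1 O (q ∘ k)).

Definition exact2 O A B C (f : hom1 A B) (g : hom1 B C) : Prop :=
  [/\ normal1 O f, normal1 O g &
      exists I (m : hom1 I B), is_image O f m /\ is_2kernel O g m].

End TwoExactness.

Record complete_lattice := CompleteLattice {
  cl_disp : Order.disp_t;
  cl_sort :> porderType cl_disp;
  cl_complete : forall S : set cl_sort, supremums S !=set0 }.

Record sup_map (A B : complete_lattice) := SupMap {
  sup_fun :> A -> B;
  sup_funP : forall (S : set A) (x : A),
    supremums S x -> supremums (sup_fun @` S) (sup_fun x) }.

Lemma sup_map_ext (A B : complete_lattice) (f g : sup_map A B) :
  (f : A -> B) = g -> f = g.
Proof.
case: f g => [f fP] [g gP] /= fg; subst g.
by congr SupMap; exact: Prop_irrelevance.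
Qed.

Lemma sup_map_homo (A B : complete_lattice) (f : sup_map A B) :
  {homo f : x y / (x <= y)%O}.
Proof.
move=> x y xy.
have xyP : supremums [set x; y] y.
  by split=> [z [->|->]//|z zub]; apply: zub; right.
by have [ub _] := sup_funP f xyP; apply: ub; exists x => //; left.
Qed.

Program Definition sup_id (A : complete_lattice) : sup_map A A :=
  @SupMap A A id _.
Next Obligation. by move=> A S x; rewrite image_id. Qed.

Program Definition sup_comp (A B C : complete_lattice)
    (g : sup_map B C) (f : sup_map A B) : sup_map A C :=
  @SupMap A C (g \o f) _.
Next Obligation.
by move=> A B C g f S x Sx; rewrite -image_comp; do 2!apply: sup_funP.
Qed.

Program Definition sup_hom (A B : complete_lattice) : category :=
  @Category (sup_map A B) (fun f g => forall x, (f x <= g x)%O)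
    (fun f x => lexx (f x))
    (fun f g h gh fg x => le_trans (fg x) (gh x)) _ _ _.
Next Obligation. by move=> *; exact: Prop_irrelevance. Qed.
Next Obligation. by move=> *; exact: Prop_irrelevance. Qed.
Next Obligation. by move=> *; exact: Prop_irrelevance. Qed.

Lemma sup_comp_le (A B C : complete_lattice)
    (g g' : sup_map B C) (f f' : sup_map A B) :
  (forall x, g x <= g' x)%O -> (forall x, f x <= f' x)%O ->
  forall x, (sup_comp g f x <= sup_comp g' f' x)%O.
Proof. by move=> gg' ff' x; exact: le_trans (sup_map_homo g (ff' x)) (gg' _). Qed.

Lemma sup_cell_eq (A B : complete_lattice) (f g : sup_hom A B)
  (a b : chom f g) : a = b.
Proof. exact: (@Prop_irrelevance (forall x, (f x <= g x)%O)). Qed.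

Program Definition Sup : two_category :=
  @TwoCategory complete_lattice sup_hom sup_id sup_comp sup_comp_le
    _ _ _ _ _ _ _ _.
Next Obligation. by move=> *; exact: sup_cell_eq. Qed.
Next Obligation. by move=> *; exact: sup_cell_eq. Qed.
Next Obligation. by move=> *; exact: sup_map_ext. Qed.
Next Obligation. by move=> *; exact: sup_map_ext. Qed.
Next Obligation. by move=> *; exact: sup_map_ext. Qed.
Next Obligation. by move=> *; exact: sup_cell_eq. Qed.
Next Obligation. by move=> *; exact: sup_cell_eq. Qed.
Next Obligation. by move=> *; exact: sup_cell_eq. Qed.

(* The norm of a normed space over R[i] takes its values in R[i]. *)
Record hilbert_space (R : realType) := HilbertSpace {
  hil_sort :> completeNormedModType R[i];
  hil_dot : {dot hil_sort for Num.conj};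
  hil_norm : forall x : hil_sort, hil_dot x x = `|x| ^+ 2 }.

Record closed_subspace (R : realType) (H : hilbert_space R) := ClosedSubspace {
  csub_set :> set H;
  csub0 : csub_set 0;
  csubP : forall (a : R[i]) (x y : H),
    csub_set x -> csub_set y -> csub_set (a *: x + y);
  csub_closed : closed csub_set }.

Section HilbertLattice.
Variables (R : realType) (H : hilbert_space R).
Implicit Types U V W : closed_subspace H.

Lemma closed_subspace_ext U V : U = V :> set H -> U = V.
Proof.
case: U V => [U U0 UP Uc] [V V0 VP Vc] /= UV; subst V.
by congr ClosedSubspace; exact: Prop_irrelevance.
Qed.

HB.instance Definition _ := gen_eqMixin (closed_subspace H).
HB.instance Definition _ := gen_choiceMixin (closed_subspace H).

Definition csub_le U V : bool := `[< U `<=` V >].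

Lemma csub_le_refl : reflexive csub_le.
Proof. by move=> U; exact/asboolP. Qed.

Lemma csub_le_anti : antisymmetric csub_le.
Proof.
by move=> U V /andP[/asboolP UV /asboolP VU]; apply/closed_subspace_ext/seteqP.
Qed.

Lemma csub_le_trans : transitive csub_le.
Proof.
by move=> V U W /asboolP UV /asboolP VW; apply/asboolP => x /UV /VW.
Qed.

HB.instance Definition _ := Order.Le_isPOrder.Build (Order.Disp tt tt)
  (closed_subspace H) csub_le_refl csub_le_anti csub_le_trans.

Lemma closed_subspace_complete (S : set (closed_subspace H)) :
  supremums S !=set0.
Proof.
pose M := \bigcap_(V in ubound S) (V : set H).
have M0 : M 0 by move=> V _; exact: csub0.
have MP a x y : M x -> M y -> M (a *: x + y).
  by move=> Mx My V VS; apply: csubP; [exact: Mx|exact: My].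
have Mc : closed M by apply: closed_bigI => V _; exact: csub_closed.
exists (ClosedSubspace M0 MP Mc); split=> [U SU|V SV]; apply/asboolP => x.
  by move=> Ux V /(_ _ SU)/asboolP; exact.
by move=> /(_ _ SV).
Qed.

Definition hilbert_lattice : complete_lattice :=
  CompleteLattice closed_subspace_complete.

End HilbertLattice.

Definition lattice_isomorphic (A B : complete_lattice) : Prop :=
  exists2 f : A -> B, bijective f & {mono f : x y / (x <= y)%O}.

Definition SupHil (R : realType) : two_category :=
  @full_sub Sup (fun A : complete_lattice =>
    exists H : hilbert_space R, lattice_isomorphic A (hilbert_lattice H)).

(* Main.v *)
Require Import Defs.
From mathcomp Require Import all_boot reals.
From HB Require Import structures.
From mathcomp Require Import all_order all_algebra complex ring lra.
From mathcomp Require Import boolp classical_sets functions topology.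
From mathcomp Require Import normedtype sequences.

(** Hom-categories of complete lattices are partial orders, so isomorphic 1-cells
    are equal and every 2-categorical notion becomes a statement about joins.
    - A 2-kernel of [f] is, up to isomorphism, the inclusion of the interval
      below the largest [x] with [f x = 0] ([is_2kernelE]); a 2-cokernel is the
      map [x |-> x \/ f 1] onto the interval above [f 1] ([is_2cokernelE]). Both
      exist between Hilbert lattices: a closed subspace [U] is a Hilbert space
      ([csub_incl_exists]), and the interval above [U] is isomorphic to the
      interval below its orthogonal complement by the orthomodular law
      ([quot_of_incl], [hperp_ortho]), which follows from the projection theorem
      ([projection]). The zero object is the one-element lattice.
    - A map [f] is normal when it restricts to an isomorphism from the interval
      above its kernel to the interval below [f 1] ([normal1E]). For normal [f]
      and [g], the composite [g f] is normal if and only if [f 1] and the kernel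
      of [g] form a modular and dual modular pair ([normal_comp]).
    - In a Hilbert lattice [(U, V)] is dual modular if and only if the closed join
      of [U] and [V] is their algebraic sum ([dual_modular_pairE]), a symmetric
      condition. Orthocomplementation exchanges modular and dual modular pairs,
      so being a modular and dual modular pair is symmetric
      ([hil_normal_pair_sym]); that symmetry is condition (DPN).
    - In the space of square-summable sequences the sequences vanishing at odd
      indices and the graph of [x |-> 2^-k x] from even to odd indices have a
      dense sum which is not the whole space, so the corresponding antinormal map
      is not normal ([non_dual_modular]).
    - In the Snake Lemma the connecting map sends [x] to the class of [v] in the
      cokernel of [f] whenever [x = b y] and [g y = c v]. Normality of the maps induced by [b]
      on kernels and by [c] on cokernels is where the symmetry of the pairs is
      used: it reduces them to the normality of [c f] and [h b]
      ([normal_ker_b], [normal_cok_c]). The remaining claims are computations with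
      intervals ([snake_lemma]). *)

Set Implicit Arguments.
Unset Strict Implicit.
Unset Printing Implicit Defensive.

Import Order.TTheory GRing.Theory Num.Theory.
Import numFieldNormedType.Exports.

Local Open Scope classical_set_scope.
Local Open Scope ring_scope.
Local Open Scope complex_scope.
Local Open Scope two_cat_scope.

(** * Complete lattices and join-preserving maps *)

Section CompleteLattice.
Variable A : complete_lattice.
Implicit Types (x y z : A) (S : set A).

(** The supremum of [S], selected by choice among its suprema (it is unique). *)
Definition csup S : A := projT1 (cid (cl_complete S)).

Lemma csupP S : supremums S (csup S).
Proof. exact: projT2 (cid (cl_complete S)). Qed.

Lemma csup_ub S x : S x -> (x <= csup S)%O.
Proof. by move=> Sx; case: (csupP S) => + _; exact. Qed.

Lemma csup_le S y : (forall x, S x -> (x <= y)%O) -> (csup S <= y)%O.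
Proof. by move=> Sy; case: (csupP S) => _; apply. Qed.

Lemma supremums_csup S x : supremums S x -> x = csup S.
Proof.
case=> xub xle; apply/eqP; rewrite eq_le csup_le // andbT.
by apply: xle => y Sy; exact: csup_ub.
Qed.

(** The bounds and the binary operations of a complete lattice, all obtained
    from [csup]. *)
Definition cbot : A := csup set0.
Definition ctop : A := csup setT.
Definition cjoin x y : A := csup [set x; y].
Definition cmeet x y : A := csup [set z | (z <= x)%O /\ (z <= y)%O].

Lemma cbot_le x : (cbot <= x)%O.
Proof. exact: csup_le. Qed.

Lemma le_ctop x : (x <= ctop)%O.
Proof. exact: csup_ub. Qed.

Lemma cjoin_le x y z : (cjoin x y <= z)%O = (x <= z)%O && (y <= z)%O.
Proof.
apply/idP/andP => [xyz|[xz yz]]; last by apply: csup_le => t [->|->].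
by split; apply: le_trans xyz; apply: csup_ub; [left|right].
Qed.

Lemma le_cmeet x y z : (z <= cmeet x y)%O = (z <= x)%O && (z <= y)%O.
Proof.
apply/idP/andP => [zxy|[zx zy]]; last by apply: csup_ub.
by split; apply: (le_trans zxy); apply: csup_le => t [].
Qed.

Lemma cjoinl x y : (x <= cjoin x y)%O.
Proof. by have := lexx (cjoin x y); rewrite cjoin_le => /andP[]. Qed.

Lemma cjoinr x y : (y <= cjoin x y)%O.
Proof. by have := lexx (cjoin x y); rewrite cjoin_le => /andP[]. Qed.

Lemma cmeetl x y : (cmeet x y <= x)%O.
Proof. by have := lexx (cmeet x y); rewrite le_cmeet => /andP[]. Qed.

Lemma cmeetr x y : (cmeet x y <= y)%O.
Proof. by have := lexx (cmeet x y); rewrite le_cmeet => /andP[]. Qed.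

Lemma le_cbot x : (x <= cbot)%O -> x = cbot.
Proof. by move=> x0; apply/eqP; rewrite eq_le x0 cbot_le. Qed.

Lemma cjoin_idr x y : (y <= x)%O -> cjoin x y = x.
Proof. by move=> yx; apply/eqP; rewrite eq_le cjoin_le lexx yx cjoinl. Qed.

Lemma cjoin_idl x y : (x <= y)%O -> cjoin x y = y.
Proof. by move=> xy; apply/eqP; rewrite eq_le cjoin_le lexx xy cjoinr. Qed.

Lemma cjoinC x y : cjoin x y = cjoin y x.
Proof. by apply/eqP; rewrite eq_le !cjoin_le !cjoinl !cjoinr. Qed.

End CompleteLattice.

Arguments cbot {A}.
Arguments ctop {A}.

Section SupMaps.
Variables A B : complete_lattice.
Implicit Types (f : sup_map A B) (x y : A) (w : B).

(** The right adjoint of a join-preserving map; [radj f cbot] is the largest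
    element sent to the bottom, so it plays the role of the kernel of [f]. *)
Definition radj f w : A := csup [set x | (f x <= w)%O].

Lemma sup_map_csup f (S : set A) : f (csup S) = csup (f @` S).
Proof. by apply: supremums_csup; apply: sup_funP; exact: csupP. Qed.

Lemma le_radj f x w : (x <= radj f w)%O = (f x <= w)%O.
Proof.
apply/idP/idP => [/(sup_map_homo f)|fxw]; last exact: csup_ub.
by move=> /le_trans; apply; rewrite sup_map_csup; apply: csup_le => _ [z zw <-].
Qed.

Lemma sup_map_bot f : f cbot = cbot.
Proof. by apply: le_cbot; rewrite -le_radj cbot_le. Qed.

Lemma sup_map_join f x y : f (cjoin x y) = cjoin (f x) (f y).
Proof.
apply/eqP; rewrite eq_le cjoin_le !sup_map_homo ?cjoinl ?cjoinr // andbT.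
by rewrite -le_radj cjoin_le !le_radj cjoinl cjoinr.
Qed.

Lemma radj_unit f x : (x <= radj f (f x))%O.
Proof. by rewrite le_radj. Qed.

Lemma radj_counit f w : (f (radj f w) <= w)%O.
Proof. by rewrite -le_radj. Qed.

Lemma radj_homo f : {homo radj f : v w / (v <= w)%O}.
Proof. by move=> v w vw; rewrite le_radj (le_trans (radj_counit f v)). Qed.

(** Every left adjoint preserves joins; all the join-preserving maps below are
    built in this way. *)
Lemma sup_map_galois (g : A -> B) (h : B -> A) :
  (forall x w, (g x <= w)%O = (x <= h w)%O) ->
  exists f : sup_map A B, f =1 g.
Proof.
move=> gh.
have gP (S : set A) x : supremums S x -> supremums (g @` S) (g x).
  move=> Sx; split=> [_ [y Sy <-]|w wub].
    rewrite gh; apply: (le_trans (proj1 Sx _ Sy)); by rewrite -gh.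
  rewrite gh; apply: (proj2 Sx) => y Sy; rewrite -gh; apply: wub.
  by exists y.
by exists (SupMap gP).
Qed.

End SupMaps.

Section TestMaps.
Variables A B : complete_lattice.

(** The maps of [sup_map_elt] represent the elements of the codomain, those of
    [sup_map_test] the principal downsets of the domain. They turn the universal
    properties of 2-kernels and 2-cokernels into elementwise statements. *)
Lemma sup_map_elt (b : B) : exists f : sup_map A B,
  f cbot = cbot /\ forall x, x <> cbot -> f x = b.
Proof.
pose g x := if x == cbot :> A then cbot else b.
have [x w|f fg] := @sup_map_galois A B g (fun w => if (b <= w)%O then ctop else cbot).
  rewrite /g; case: eqP => [->|xN0]; first by rewrite !cbot_le.
  by case: ifP => _; [rewrite le_ctop|apply/esym/negP => /le_cbot].
exists f; rewrite fg /g eqxx; split=> // x /eqP xN0.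
by rewrite fg /g (negPf xN0).
Qed.

Lemma sup_map_test (a : A) : exists f : sup_map A B,
  forall x, f x = if (x <= a)%O then cbot else ctop.
Proof.
have [x w|f fg] := @sup_map_galois A B (fun x => if (x <= a)%O then cbot else ctop)
  (fun w => if (ctop <= w)%O then ctop else a).
  case: ifP => xa; first by rewrite cbot_le; case: ifP => _; rewrite ?le_ctop ?xa.
  by case: ifP => wt; rewrite ?le_ctop ?xa.
by exists f.
Qed.

End TestMaps.

Section Inclusions.
Variables A B : complete_lattice.

(** [k] is an order embedding whose range is the interval below [a]. *)
Definition is_incl (a : A) (k : sup_map B A) : Prop :=
  (forall x y, (k x <= k y)%O -> (x <= y)%O) /\
  (forall x, (x <= a)%O <-> exists y, k y = x).

(** [q] is, up to isomorphism, the map [x |-> x \/ a] onto the interval above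
    [a]. *)
Definition is_quot (a : A) (q : sup_map A B) : Prop :=
  (forall w, exists x, q x = w) /\
  (forall x y, (q x <= q y)%O = (x <= cjoin y a)%O).

Lemma incl_le a k : is_incl a k -> forall x y, (k x <= k y)%O = (x <= y)%O.
Proof. by case=> kI _ x y; apply/idP/idP => [/kI|/sup_map_homo]. Qed.

Lemma incl_inj a k : is_incl a k -> injective k.
Proof.
move=> ka x y kxy; apply/eqP.
by rewrite eq_le -!(incl_le ka) kxy lexx.
Qed.

Lemma incl_leq a k y : is_incl a k -> (k y <= a)%O.
Proof. by case=> _ kS; apply/kS; exists y. Qed.

Lemma incl_radjK a k x : is_incl a k -> (x <= a)%O -> k (radj k x) = x.
Proof.
move=> ka /(proj2 ka)[y <-]; congr (k _); apply/eqP.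
by rewrite eq_le radj_unit andbT -(incl_le ka) radj_counit.
Qed.

Lemma incl_top a k : is_incl a k -> k ctop = a.
Proof.
move=> ka; apply/eqP; rewrite eq_le incl_leq //=.
by rewrite -(incl_radjK ka (lexx a)) (incl_le ka) le_ctop.
Qed.

Lemma incl_bot a k x : is_incl a k -> k x = cbot -> x = cbot.
Proof. by move=> ka; rewrite -(sup_map_bot k) => /(incl_inj ka). Qed.

Lemma incl_radj a k : is_incl a k -> cancel k (radj k).
Proof. by move=> ka x; apply: (incl_inj ka); rewrite (incl_radjK ka) ?incl_leq. Qed.

Lemma quot_bot a q x : is_quot a q -> (q x <= cbot)%O = (x <= a)%O.
Proof. by case=> _ qle; rewrite -(sup_map_bot q) qle cjoin_idl ?cbot_le. Qed.

Lemma quot_radjK a q w : is_quot a q -> q (radj q w) = w.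
Proof.
case=> qS qle; have [x <-] := qS w; apply/eqP.
by rewrite eq_le radj_counit /= sup_map_homo ?radj_unit.
Qed.

Lemma quot_radj a q x : is_quot a q -> radj q (q x) = cjoin x a.
Proof.
move=> qa; have [qS qle] := qa; apply/eqP; rewrite eq_le.
rewrite -qle (quot_radjK _ qa) lexx /= cjoin_le radj_unit /=.
by rewrite le_radj; apply: le_trans (cbot_le _); rewrite (quot_bot _ qa).
Qed.

Lemma quot_top a q : is_quot a q -> q ctop = ctop.
Proof.
move=> [qS _]; apply/eqP; rewrite eq_le le_ctop /=.
by have [x <-] := qS ctop; apply: sup_map_homo (le_ctop _).
Qed.

End Inclusions.

Section Factor.
Variables A B Z : complete_lattice.

Lemma incl_factor (a : A) (k : sup_map B A) (z : sup_map Z A) :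
  is_incl a k -> (z ctop <= a)%O -> exists u : sup_map Z B, k \o u =1 z.
Proof.
move=> ka za; have zle x : (z x <= a)%O.
  by apply: le_trans za; apply: sup_map_homo (le_ctop _).
have [x w|u uE] := @sup_map_galois Z B (radj k \o z) (radj z \o k).
  by rewrite /= -(incl_le ka) (incl_radjK ka) // le_radj.
by exists u => x; rewrite /= uE /= (incl_radjK ka).
Qed.

Lemma quot_factor (a : A) (q : sup_map A B) (z : sup_map A Z) :
  is_quot a q -> z a = cbot -> exists u : sup_map B Z, u \o q =1 z.
Proof.
move=> qa za; have az y : (a <= radj z y)%O by rewrite le_radj za cbot_le.
have [w y|u uE] := @sup_map_galois B Z (z \o radj q) (q \o radj z).
  have [x <-] := proj1 qa w.
  rewrite /= (quot_radj _ qa) sup_map_join za (proj2 qa).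
  by rewrite cjoin_le cbot_le andbT -le_radj cjoin_idr.
by exists u => x; rewrite /= uE /= (quot_radj _ qa) sup_map_join za cjoin_idr ?cbot_le.
Qed.

End Factor.

(** * Modular pairs and normal maps *)

Section NormalPairs.
Variable A : complete_lattice.

(** Modularity of the pair, [a /\ (y \/ b) <= y \/ (a /\ b)] for [y <= a], and
    its dual. Together they say that [x |-> x \/ b] is an isomorphism from the
    interval between [a /\ b] and [a] onto the one between [b] and [a \/ b]. *)
Definition modular_pair (a b : A) : Prop :=
  forall x y, (x <= a)%O -> (y <= a)%O ->
    (x <= cjoin y b)%O -> (x <= cjoin y (cmeet a b))%O.

Definition dual_modular_pair (a b : A) : Prop :=
  forall z, (b <= z)%O -> (z <= cjoin a b)%O -> (z <= cjoin (cmeet z a) b)%O.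

Definition normal_pair (a b : A) : Prop :=
  modular_pair a b /\ dual_modular_pair a b.

End NormalPairs.

(** [f] restricts to an isomorphism from the interval above its kernel onto the
    interval below [f ctop]. *)
Definition normal_map (A B : complete_lattice) (f : sup_map A B) : Prop :=
  (forall x y, (f x <= f y)%O -> (x <= cjoin y (radj f cbot))%O) /\
  (forall w, (w <= f ctop)%O -> exists x, f x = w).

Section NormalMaps.

Lemma normal_map_comp_incl (A B C : complete_lattice) a
    (k : sup_map B C) (f : sup_map A B) :
  is_incl a k -> normal_map (sup_comp k f) <-> normal_map f.
Proof.
move=> ka.
have radjE : radj (sup_comp k f) cbot = radj f cbot.
  apply/eqP; rewrite eq_le !le_radj -(incl_le ka) (sup_map_bot k).
  rewrite (radj_counit (sup_comp k f)) /= -(sup_map_bot k) (incl_le ka).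
  exact: radj_counit.
split=> -[f1 f2]; split=> [x y fxy|w wf].
- by rewrite -radjE; apply: f1; rewrite /= (incl_le ka).
- have [|x /= /(incl_inj ka)] := f2 (k w); first by rewrite /= (incl_le ka).
  by exists x.
- by rewrite radjE; apply: f1; rewrite -(incl_le ka).
- have /(proj2 ka)[v vw] : (w <= a)%O.
    exact: le_trans wf (incl_leq _ ka).
  move: wf; rewrite -vw (incl_le ka) => /f2[x xv].
  by exists x; rewrite /= xv.
Qed.

Lemma normal_map_comp_quot (A B C : complete_lattice) a
    (f : sup_map B C) (q : sup_map A B) :
  is_quot a q -> normal_map (sup_comp f q) <-> normal_map f.
Proof.
move=> qa.
have radjE : cjoin (radj (sup_comp f q) cbot) a = radj (sup_comp f q) cbot.
  rewrite cjoin_idr // le_radj /=.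
  have /eqP -> : q a == cbot by rewrite eq_le cbot_le (quot_bot _ qa) lexx.
  by rewrite sup_map_bot.
have qradj : q (radj (sup_comp f q) cbot) = radj f cbot.
  apply/eqP; rewrite eq_le le_radj (radj_counit (sup_comp f q)) /=.
  have [n nE] := proj1 qa (radj f cbot); rewrite -nE.
  by rewrite sup_map_homo // le_radj /= nE radj_counit.
split=> -[f1 f2]; split=> [x y fxy|w wf].
- have [[x' x'E] [y' y'E]] := (proj1 qa x, proj1 qa y); subst x y.
  by rewrite -qradj -sup_map_join; apply: sup_map_homo; apply: f1.
- have [|x xw] := f2 w; first by rewrite /= (quot_top qa).
  by exists (q x).
- have := f1 _ _ fxy; rewrite -qradj -sup_map_join (proj2 qa).
  move=> /le_trans; apply; rewrite cjoin_le lexx /= -radjE.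
  by apply: le_trans (cjoinr _ _); exact: cjoinr.
- have [|v vw] := f2 w; first by move: wf; rewrite /= (quot_top qa).
  by have [x xv] := proj1 qa v; exists x; rewrite /= xv.
Qed.

Lemma incl_normal (A B : complete_lattice) a (k : sup_map B A) :
  is_incl a k -> normal_map k.
Proof.
move=> ka; split=> [x y|w]; rewrite ?(incl_le ka) ?(incl_top ka).
  by move=> xy; apply: le_trans xy (cjoinl _ _).
by move=> /(proj2 ka).
Qed.

Lemma quot_normal (A B : complete_lattice) a (q : sup_map A B) :
  is_quot a q -> normal_map q.
Proof.
move=> qa; split=> [x y|w _]; last exact: (proj1 qa).
rewrite (proj2 qa) => /le_trans; apply.
rewrite cjoin_le cjoinl /=; apply: le_trans (cjoinr _ _).
by rewrite le_radj (quot_bot _ qa).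
Qed.

Lemma quot_kernel (A B : complete_lattice) a (q : sup_map A B) :
  is_quot a q -> radj q cbot = a.
Proof.
by move=> qa; rewrite -(sup_map_bot q) (quot_radj _ qa) cjoin_idl ?cbot_le.
Qed.

Lemma normal_incl (A B : complete_lattice) (f : sup_map A B) :
  normal_map f -> radj f cbot = cbot -> is_incl (f ctop) f.
Proof.
case=> f1 f2 f0; split=> [x y /f1|x]; first by rewrite f0 cjoin_idr ?cbot_le.
by split=> [/f2//|[y <-]]; exact: sup_map_homo (le_ctop _).
Qed.

Lemma normal_quot (A B : complete_lattice) (f : sup_map A B) :
  normal_map f -> f ctop = ctop -> is_quot (radj f cbot) f.
Proof.
case=> f1 f2 ft; split=> [w|x y]; first by apply: f2; rewrite ft le_ctop.
apply/idP/idP => [/f1//|/(sup_map_homo f)/le_trans]; apply.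
rewrite sup_map_join cjoin_le lexx /=.
exact: le_trans (radj_counit _ _) (cbot_le _).
Qed.

(** The key fact on composites: only the relative position of the image of [f]
    and of the kernel of [g] matters. *)
Lemma normal_comp (A B C : complete_lattice) (f : sup_map A B)
    (g : sup_map B C) :
  normal_map f -> normal_map g ->
  normal_map (sup_comp g f) <-> normal_pair (f ctop) (radj g cbot).
Proof.
move=> [f1 f2] [g1 g2].
have gE y : g (cjoin y (radj g cbot)) = g y.
  by rewrite sup_map_join cjoin_idr // (le_trans (radj_counit _ _)) ?cbot_le.
have fle x : (f x <= f ctop)%O by exact: sup_map_homo (le_ctop _).
set k := radj (sup_comp g f) cbot.
have fk : f k = cmeet (f ctop) (radj g cbot).
  apply/eqP; rewrite eq_le le_cmeet fle /= le_radj.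
  rewrite (radj_counit (sup_comp g f)) /=.
  have [n nE] := f2 _ (cmeetl (f ctop) (radj g cbot)).
  by rewrite -nE sup_map_homo // le_radj /= nE -le_radj cmeetr.
split=> -[p1 p2]; split.
- move=> _ _ /f2[x <-] /f2[y <-] xy; rewrite -fk -sup_map_join.
  by apply/sup_map_homo/p1; rewrite /= -(gE (f y)) sup_map_homo.
- move=> z kz zr; have [|x /= xz] := p2 (g z).
    by rewrite /= -(gE (f ctop)) sup_map_homo.
  have fxz : (f x <= z)%O by rewrite -(cjoin_idr kz); apply: g1; rewrite xz.
  apply: (@le_trans _ _ (cjoin (f x) (radj g cbot))); first by apply: g1; rewrite xz.
  rewrite cjoin_le cjoinr andbT; apply: le_trans (cjoinl _ _).
  by rewrite le_cmeet fxz fle.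
- move=> x y /g1/(p1 _ _ (fle x) (fle y)); rewrite -fk -sup_map_join => /f1.
  move=> /le_trans; apply; rewrite cjoin_le lexx /=.
  apply: le_trans (cjoinr _ _); rewrite le_radj /=.
  by rewrite -le_radj (le_trans (radj_counit _ _)) ?cbot_le.
- move=> w /= wgf; have [|z zw] := g2 w.
    by apply: le_trans wgf _; exact: sup_map_homo (le_ctop _).
  subst w; have zr : (cjoin z (radj g cbot) <= cjoin (f ctop) (radj g cbot))%O.
    by rewrite cjoin_le cjoinr andbT; apply: g1.
  have [n nE] := f2 _ (cmeetr (cjoin z (radj g cbot)) (f ctop)).
  exists n; rewrite /= nE; apply/eqP; rewrite eq_le; apply/andP; split.
    by rewrite -(gE z) sup_map_homo ?cmeetl.
  rewrite -(gE (cmeet _ _)); apply: sup_map_homo.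
  exact: le_trans (cjoinl _ _) (p2 _ (cjoinr _ _) zr).
Qed.

End NormalMaps.

(** * Composition of inclusions and quotients, and the snake lemma in lattices *)

Section Composition.
Variables A B C : complete_lattice.

Lemma incl_comp a b (k : sup_map A B) (l : sup_map B C) :
  is_incl a k -> is_incl b l -> is_incl (l a) (sup_comp l k).
Proof.
move=> ka lb; split=> [x y|x]; first by rewrite /= (incl_le lb) (incl_le ka).
split=> [xla|[y <-]]; last by rewrite /= (incl_le lb) (incl_leq _ ka).
have [z zE] := proj1 (proj2 lb x) (le_trans xla (incl_leq _ lb)).
move: xla; rewrite -zE (incl_le lb) => /(proj2 ka)[y <-].
by exists y.
Qed.

Lemma quot_comp a b (p : sup_map A B) (q : sup_map B C) :
  is_quot a p -> is_quot b q -> is_quot (radj p b) (sup_comp q p).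
Proof.
move=> pa qb; split=> [w|x y].
  have [v <-] := proj1 qb w; have [x <-] := proj1 pa v.
  by exists x.
rewrite /= (proj2 qb) -[in LHS](quot_radjK b pa) -sup_map_join (proj2 pa).
rewrite [cjoin _ a]cjoin_idr //; apply: le_trans (cjoinr _ _).
by rewrite le_radj; apply: le_trans (cbot_le _); rewrite (quot_bot _ pa).
Qed.

End Composition.

(** The data of the Snake Lemma, with exactness of the two rows expressed by
    equalities between images [ctop] and kernels [radj _ cbot]. *)
Section Snake.
Variables A B C X Y Z : complete_lattice.
Variables (a : sup_map A B) (b : sup_map B C) (c : sup_map X Y) (d : sup_map Y Z).
Variables (f : sup_map A X) (g : sup_map B Y) (h : sup_map C Z).
Hypothesis gaE : forall x, g (a x) = c (f x).
Hypothesis hbE : forall x, h (b x) = d (g x).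
Hypotheses (aN : normal_map a) (bN : normal_map b).
Hypotheses (cN : normal_map c) (dN : normal_map d).
Hypotheses (fN : normal_map f) (gN : normal_map g) (hN : normal_map h).
Hypotheses (kerb : radj b cbot = a ctop) (b_top : b ctop = ctop).
Hypotheses (kerc : radj c cbot = cbot) (kerd : radj d cbot = c ctop).
Hypothesis symB : forall x y : B, normal_pair x y -> normal_pair y x.
Hypothesis symY : forall x y : Y, normal_pair x y -> normal_pair y x.
Variables Kf Kg Kh Qf Qg Qh : complete_lattice.
Variables (kf : sup_map Kf A) (kg : sup_map Kg B) (kh : sup_map Kh C).
Variables (qf : sup_map X Qf) (qg : sup_map Y Qg) (qh : sup_map Z Qh).
Hypotheses (kfI : is_incl (radj f cbot) kf) (kgI : is_incl (radj g cbot) kg)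
  (khI : is_incl (radj h cbot) kh).
Hypotheses (qfQ : is_quot (f ctop) qf) (qgQ : is_quot (g ctop) qg)
  (qhQ : is_quot (h ctop) qh).
Variables (a' : sup_map Kf Kg) (b' : sup_map Kg Kh).
Variables (c' : sup_map Qf Qg) (d' : sup_map Qg Qh).
Hypothesis aE : forall x, kg (a' x) = a (kf x).
Hypothesis bE : forall x, kh (b' x) = b (kg x).
Hypothesis cE : forall x, c' (qf x) = qg (c x).
Hypothesis dE : forall x, d' (qg x) = qh (d x).

Let bQ : is_quot (a ctop) b.
Proof. by rewrite -kerb; exact: normal_quot. Qed.

Let cI : is_incl (c ctop) c.
Proof. exact: normal_incl. Qed.

Let le_top (U V : complete_lattice) (p : sup_map U V) x : (p x <= p ctop)%O.
Proof. exact: sup_map_homo (le_ctop _). Qed.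

Let ker_bot (U V : complete_lattice) (p : sup_map U V) : p (radj p cbot) = cbot.
Proof. exact/le_cbot/radj_counit. Qed.

Let kf_bot x : f (kf x) = cbot.
Proof. by apply: le_cbot; rewrite -le_radj (incl_leq _ kfI). Qed.

Let kg_bot x : g (kg x) = cbot.
Proof. by apply: le_cbot; rewrite -le_radj (incl_leq _ kgI). Qed.

Let kh_bot x : h (kh x) = cbot.
Proof. by apply: le_cbot; rewrite -le_radj (incl_leq _ khI). Qed.

Let qf_bot x : qf (f x) = cbot.
Proof. by apply: le_cbot; rewrite (quot_bot _ qfQ). Qed.

Let qg_bot x : qg (g x) = cbot.
Proof. by apply: le_cbot; rewrite (quot_bot _ qgQ). Qed.

Let qh_bot x : qh (h x) = cbot.
Proof. by apply: le_cbot; rewrite (quot_bot _ qhQ). Qed.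

Let ba_bot x : b (a x) = cbot.
Proof. by apply: le_cbot; rewrite (quot_bot _ bQ). Qed.

Let dc_bot x : d (c x) = cbot.
Proof. by apply: le_cbot; rewrite -le_radj kerd. Qed.

Let h_top : h ctop = d (g ctop).
Proof. by rewrite -b_top hbE. Qed.

(** As [c] is injective, the elements whose image under [a] is killed by [g] are
    those in the kernel of [f]. *)
Lemma kernel_lift n : g (a n) = cbot -> exists m, kf m = n.
Proof.
rewrite gaE => /(incl_bot cI) fn.
by apply/(proj1 (proj2 kfI n)); rewrite le_radj fn.
Qed.

Lemma normal_ker_a : normal_map a'.
Proof.
apply/(normal_map_comp_incl a' kgI).
have -> : sup_comp kg a' = sup_comp a kf by apply/sup_map_ext/funext.
have [m mE] : exists m, kf m = radj a cbot.
  by apply: kernel_lift; rewrite ker_bot sup_map_bot.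
split=> [x y /= /(proj1 aN)|w /= wa].
  rewrite -mE -sup_map_join (incl_le kfI) => /le_trans; apply.
  rewrite cjoin_le cjoinl; apply: le_trans (cjoinr _ _).
  by rewrite le_radj /= mE ker_bot.
have [x xw] := proj2 aN _ (le_trans wa (le_top _ _)); subst w.
have [|m' m'E] := @kernel_lift x; last by exists m'; rewrite m'E.
apply: le_cbot; apply: le_trans (sup_map_homo g wa) _.
by rewrite gaE kf_bot sup_map_bot.
Qed.

Lemma exact_Kg : radj b' cbot = a' ctop.
Proof.
apply/eqP; rewrite eq_le le_radj; apply/andP; split; last first.
  by rewrite -(incl_le khI) bE aE ba_bot cbot_le.
set n := radj b' cbot.
have bn : (b (kg n) <= cbot)%O by rewrite -bE ker_bot sup_map_bot.
rewrite (quot_bot _ bQ) in bn.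
have [x xE] := proj2 aN _ bn.
have [|m mE] := @kernel_lift x; first by rewrite xE kg_bot.
by rewrite -(incl_le kgI) aE -xE -mE; apply: sup_map_homo; exact: le_top.
Qed.

(** [b'] is a restriction of [b], so it is normal as soon as [(ker g, im a)] is a
    normal pair. The swapped pair is normal because [g a = c f] is normal. *)
Lemma normal_ker_b : normal_map b'.
Proof.
apply/(normal_map_comp_incl b' khI).
have -> : sup_comp kh b' = sup_comp b kg by apply/sup_map_ext/funext.
apply/(normal_comp (incl_normal kgI) bN).
rewrite (incl_top kgI) kerb; apply: symB.
apply/(normal_comp aN gN).
have -> : sup_comp g a = sup_comp c f by apply/sup_map_ext/funext.
exact/(normal_map_comp_incl f cI).
Qed.

(** Dual to [normal_ker_b], using that [d g = h b] is normal. *)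
Lemma normal_cok_c : normal_map c'.
Proof.
apply/(normal_map_comp_quot c' qfQ).
have -> : sup_comp c' qf = sup_comp qg c by apply/sup_map_ext/funext.
apply/(normal_comp cN (quot_normal qgQ)).
rewrite (quot_kernel qgQ); apply: symY; rewrite -kerd; apply/(normal_comp gN dN).
have -> : sup_comp d g = sup_comp h b by apply/sup_map_ext/funext => x; rewrite /= hbE.
exact/(normal_map_comp_quot h bQ).
Qed.

Lemma normal_cok_d : normal_map d'.
Proof.
apply/(normal_map_comp_quot d' qgQ).
have -> : sup_comp d' qg = sup_comp qh d by apply/sup_map_ext/funext.
split=> [x y|w] /=.
  rewrite (proj2 qhQ) h_top -sup_map_join => /(proj1 dN)/le_trans; apply.
  rewrite !cjoin_le cjoinl /=; apply/andP; split.
    by apply: le_trans (cjoinr _ _); rewrite le_radj /= -h_top qh_bot.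
  apply: le_trans (cjoinr _ _); rewrite le_radj /=.
  by rewrite ker_bot sup_map_bot.
have [v <-] := proj1 qhQ w; rewrite (proj2 qhQ) h_top cjoin_idr ?le_top // => vd.
by have [x <-] := proj2 dN v vd; exists x.
Qed.

Lemma exact_Qg : radj d' cbot = c' ctop.
Proof.
rewrite -(quot_top qfQ) cE.
apply/eqP; rewrite eq_le le_radj; apply/andP; split; last first.
  by rewrite dE dc_bot sup_map_bot.
set n := radj d' cbot; have [y yE] := proj1 qgQ n.
have : (qh (d y) <= cbot)%O by rewrite -dE yE ker_bot.
rewrite (quot_bot _ qhQ) h_top => /(proj1 dN).
rewrite kerd cjoinC -yE => /(sup_map_homo qg)/le_trans; apply.
by rewrite sup_map_join qg_bot cjoin_le lexx cbot_le.
Qed.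

(** The connecting map is the composite of [kh], of the isomorphism from the
    interval below [ker h] to the part of the domain of [g] above [im a], of [g],
    of the inverse of [c] on its image, and of [qf]. *)
Lemma connecting_exists : exists del : sup_map Kh Qf,
  forall x y v, kh x = b y -> g y = c v -> del x = qf v.
Proof.
have gradj w : (a ctop <= radj g (c (radj qf w)))%O.
  by rewrite le_radj gaE (incl_le cI) le_radj qf_bot cbot_le.
have gle x : (g (radj b (kh x)) <= c ctop)%O.
  rewrite -kerd le_radj -hbE (quot_radjK _ bQ); by rewrite kh_bot cbot_le.
have [x w|del delE] := @sup_map_galois Kh Qf
  (fun x => qf (radj c (g (radj b (kh x)))))
  (fun w => radj kh (b (radj g (c (radj qf w))))).
  rewrite -le_radj -(incl_le cI) (incl_radjK cI) // -le_radj.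
  rewrite -{1}(cjoin_idr (gradj w)) -(quot_radj _ bQ) [RHS]le_radj.
  apply/idP/idP => [xy|]; last exact: radj_homo.
  by have := sup_map_homo b xy; rewrite !(quot_radjK _ bQ).
exists del => x y v xy gv; rewrite delE xy (quot_radj _ bQ).
rewrite sup_map_join gv gaE -sup_map_join (incl_radj cI).
by rewrite sup_map_join qf_bot cjoin_idr ?cbot_le.
Qed.

Section Connecting.
Variable del : sup_map Kh Qf.
Hypothesis delP : forall x y v, kh x = b y -> g y = c v -> del x = qf v.

Lemma connecting_lift x : exists y v, [/\ kh x = b y, g y = c v & del x = qf v].
Proof.
have [y yx] := proj1 bQ (kh x).
have [|v vy] := proj1 (proj2 cI (g y)).
  by rewrite -kerd le_radj -hbE yx kh_bot.
by exists y, v; split=> //; apply: (@delP x y v).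
Qed.

Lemma connecting_image v : (c v <= g ctop)%O -> exists x, del x = qf v.
Proof.
move=> /(proj2 gN)[y yv]; have [|x xy] := proj1 (proj2 khI (b y)).
  by rewrite le_radj hbE yv dc_bot.
by exists x; apply: (delP xy).
Qed.

Lemma connecting_le x x' : (del x <= del x')%O -> (x <= cjoin x' (b' ctop))%O.
Proof.
have [y [v [xy yv ->]]] := connecting_lift x.
have [y' [v' [xy' yv' ->]]] := connecting_lift x'.
rewrite (proj2 qfQ) -(incl_le cI) sup_map_join -gaE -yv -yv' -sup_map_join.
move=> /(proj1 gN); rewrite -(incl_top kgI) => /(sup_map_homo b).
rewrite !sup_map_join ba_bot [cjoin _ cbot]cjoin_idr ?cbot_le //.
by rewrite -xy -xy' -bE -sup_map_join (incl_le khI).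
Qed.

Lemma exact_Kh : radj del cbot = b' ctop.
Proof.
apply/eqP; rewrite eq_le le_radj; apply/andP; split.
  have := @connecting_le (radj del cbot) cbot.
  by rewrite ker_bot cbot_le cjoin_idl ?cbot_le //; apply.
rewrite (@delP _ (kg ctop) cbot) ?sup_map_bot ?cbot_le //.
Qed.

Lemma normal_connecting : normal_map del.
Proof.
split=> [x x' /connecting_le|w]; first by rewrite exact_Kh.
have [y1 [v1 [_ yv1 ->]]] := connecting_lift ctop.
have [v <-] := proj1 qfQ w; rewrite (proj2 qfQ) => vv1.
apply: connecting_image; move/(sup_map_homo c): vv1 => /le_trans; apply.
by rewrite sup_map_join -yv1 -gaE -sup_map_join le_top.
Qed.

Lemma exact_Qf : radj c' cbot = del ctop.
Proof.
have [y1 [v1 [_ yv1 del1]]] := connecting_lift ctop.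
apply/eqP; rewrite eq_le le_radj; apply/andP; split; last first.
  by rewrite del1 cE -yv1 qg_bot.
have [v vE] := proj1 qfQ (radj c' cbot).
have : (qg (c v) <= cbot)%O by rewrite -cE vE ker_bot.
rewrite (quot_bot _ qgQ) => /connecting_image[x]; rewrite vE => <-.
exact: le_top.
Qed.

End Connecting.

Lemma kernel_ker_a : radj a cbot = cbot -> is_incl (radj b' cbot) a'.
Proof.
move=> a0; rewrite exact_Kg; apply: (normal_incl normal_ker_a).
set n := radj a' cbot; apply: (incl_bot kfI); apply: le_cbot.
by rewrite -a0 le_radj -aE ker_bot sup_map_bot.
Qed.

Lemma cokernel_cok_d : d ctop = ctop -> is_quot (c' ctop) d'.
Proof.
move=> d1; rewrite -exact_Qg; apply: (normal_quot normal_cok_d).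
by rewrite -(quot_top qgQ) dE d1 (quot_top qhQ).
Qed.

Lemma snake_lemma :
  [/\ exists del : sup_map Kh Qf,
        [/\ [/\ normal_map a', normal_map b', normal_map del, normal_map c'
             & normal_map d'],
            radj b' cbot = a' ctop, radj del cbot = b' ctop,
            radj c' cbot = del ctop & radj d' cbot = c' ctop],
      radj a cbot = cbot -> is_incl (radj b' cbot) a'
    & d ctop = ctop -> is_quot (c' ctop) d'].
Proof.
have [del delP] := connecting_exists.
split; [exists del; split; first split| |].
- exact: normal_ker_a.
- exact: normal_ker_b.
- exact: normal_connecting.
- exact: normal_cok_c.
- exact: normal_cok_d.
- exact: exact_Kg.
- exact: exact_Kh.
- exact: exact_Qf.
- exact: exact_Qg.
- exact: kernel_ker_a.
- exact: cokernel_cok_d.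
Qed.

End Snake.

(** * Inner products over the complex numbers *)

Lemma ReD (R : rcfType) (x y : R[i]) :
  complex.Re (x + y) = complex.Re x + complex.Re y.
Proof. by case: x y => u v [w t]. Qed.

Lemma ReN (R : rcfType) (x : R[i]) : complex.Re (- x) = - complex.Re x.
Proof. by case: x. Qed.

Section RealInnerProduct.
Variables (R : realType) (V : lmodType R[i]) (form : {dot V for Num.conj}).
Implicit Types x y z : V.

(** The real part of the inner product, and the norm it defines. Since the
    subspaces considered are complex, orthogonality to a subspace may be tested
    with the real part only. *)
Definition rdot x y : R := complex.Re (form x y).
Definition hnorm x : R := Num.sqrt (rdot x x).

Lemma form_rdot x : form x x = (rdot x x)%:C.
Proof. by rewrite RRe_real // ger0_real // dnorm_ge0. Qed.

Lemma rdotC x y : rdot x y = rdot y x.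
Proof.
rewrite /rdot hermC expr0 mul1r.
by rewrite -[X in complex.Re X]/(conjc (form y x)); case: (form y x).
Qed.

Lemma rdotDl x y z : rdot (x + y) z = rdot x z + rdot y z.
Proof. by rewrite /rdot linearDl ReD. Qed.

Lemma rdotNl x y : rdot (- x) y = - rdot x y.
Proof. by rewrite /rdot linearNl ReN. Qed.

Lemma rdotDr x y z : rdot x (y + z) = rdot x y + rdot x z.
Proof. by rewrite !(rdotC x) rdotDl. Qed.

Lemma rdotNr x y : rdot x (- y) = - rdot x y.
Proof. by rewrite !(rdotC x) rdotNl. Qed.

Lemma rdot0l x : rdot 0 x = 0.
Proof. by rewrite /rdot linear0l. Qed.

Lemma rdotZl (a : R) x y : rdot (a%:C *: x) y = a * rdot x y.
Proof.
rewrite /rdot linearZl_LR /=; case: (form x y) => u v /=.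
by rewrite mul0r subr0.
Qed.

Lemma rdotZr (a : R) x y : rdot x (a%:C *: y) = a * rdot x y.
Proof. by rewrite rdotC rdotZl rdotC. Qed.

Lemma rdot_adj (a : R[i]) x y : rdot (a *: x) y = rdot x (Num.conj a *: y).
Proof. by rewrite /rdot linearZl_LR linearZr_LR /= conjCK. Qed.

Lemma rdot_ge0 x : 0 <= rdot x x.
Proof. by rewrite -lecR -form_rdot dnorm_ge0. Qed.

Lemma rdot_eq0 x : rdot x x = 0 -> x = 0.
Proof. by move=> x0; apply/eqP; rewrite -(dnorm_eq0 form) form_rdot x0. Qed.

Lemma hnorm_ge0 x : 0 <= hnorm x.
Proof. exact: sqrtr_ge0. Qed.

Lemma hnorm_sqr x : hnorm x ^+ 2 = rdot x x.
Proof. by rewrite sqr_sqrtr // rdot_ge0. Qed.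

Lemma hnorm_eq0 x : hnorm x = 0 -> x = 0.
Proof. by move=> x0; apply: rdot_eq0; rewrite -hnorm_sqr x0 expr0n. Qed.

Lemma hnorm0 : hnorm 0 = 0.
Proof. by rewrite /hnorm rdot0l sqrtr0. Qed.

Lemma hnormN x : hnorm (- x) = hnorm x.
Proof. by rewrite /hnorm rdotNl rdotNr opprK. Qed.

Lemma hnormBC x y : hnorm (x - y) = hnorm (y - x).
Proof. by rewrite -hnormN opprB. Qed.

Lemma hnormZ (a : R[i]) x : (hnorm (a *: x))%:C = `|a| * (hnorm x)%:C.
Proof.
have sqrE y : (hnorm y)%:C ^+ 2 = form y y.
  by rewrite -rmorphXn /= hnorm_sqr form_rdot.
apply/eqP; rewrite -(@eqrXn2 _ 2) ?exprMn ?sqrE ?dnormZ //.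
  by rewrite ler0c hnorm_ge0.
by rewrite mulr_ge0 // ler0c hnorm_ge0.
Qed.

Lemma CauchySchwarz_real x y : rdot x y <= hnorm x * hnorm y.
Proof.
have [x0|xN0] := eqVneq (hnorm x) 0.
  by rewrite (hnorm_eq0 x0) rdot0l hnorm0 mul0r.
have [y0|yN0] := eqVneq (hnorm y) 0.
  by rewrite (hnorm_eq0 y0) rdotC rdot0l hnorm0 mulr0.
have xy0 : 0 < hnorm x * hnorm y by rewrite mulr_gt0 // lt0r ?xN0 ?yN0 hnorm_ge0.
have := rdot_ge0 ((hnorm y)%:C *: x - (hnorm x)%:C *: y).
rewrite !(rdotDl, rdotDr, rdotNl, rdotNr, rdotZl, rdotZr) -!hnorm_sqr (rdotC y x).
move=> ?; rewrite -(ler_pM2l xy0); nra.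
Qed.

Lemma hnormD x y : hnorm (x + y) <= hnorm x + hnorm y.
Proof.
rewrite -(@ler_pXn2r _ 2) ?nnegrE ?addr_ge0 ?hnorm_ge0 //.
rewrite hnorm_sqr rdotDl !rdotDr -!hnorm_sqr (rdotC y x).
have := CauchySchwarz_real x y; nra.
Qed.

Lemma hnorm_split x y z : hnorm (x - z) <= hnorm (x - y) + hnorm (y - z).
Proof. by rewrite -[x - z](subrKA y); exact: hnormD. Qed.

Lemma parallelogram x y :
  hnorm (x - y) ^+ 2 + hnorm (x + y) ^+ 2 = 2 * (hnorm x ^+ 2 + hnorm y ^+ 2).
Proof.
rewrite !hnorm_sqr !(rdotDl, rdotDr, rdotNl, rdotNr) (rdotC y x); ring.
Qed.

(** Completeness for the norm [hnorm], in terms of Cauchy sequences. *)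
Definition dot_complete : Prop := forall u : nat -> V,
  (forall e : R, 0 < e -> exists N, forall m n, (N <= m)%N -> (N <= n)%N ->
    hnorm (u m - u n) < e) ->
  exists l, forall e : R, 0 < e -> exists N, forall n, (N <= n)%N ->
    hnorm (u n - l) < e.

End RealInnerProduct.

Lemma invS_lt (R : realType) (e : R) : 0 < e ->
  exists N, forall n, (N <= n)%N -> n.+1%:R^-1 < e.
Proof.
move=> e0; exists (Num.bound e^-1) => n Nn.
rewrite -[ltRHS]invrK ltf_pV2 ?posrE ?invr_gt0 ?ltr0n //.
apply: lt_le_trans (archi_boundP _) _; first by rewrite invr_ge0 ltW.
by rewrite ler_nat; apply: leq_trans Nn _.
Qed.

(** The module [V], renamed so that it may carry the norm and the topology of a
    complete inner product [form]. *)
Definition dot_space (R : realType) (V : lmodType R[i])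
  (form : {dot V for Num.conj}) (cform : dot_complete form) : Type := V.

Section DotSpace.
Variables (R : realType) (V : lmodType R[i]) (form : {dot V for Num.conj}).
Variable cform : dot_complete form.
Local Notation T := (dot_space cform).

HB.instance Definition _ := GRing.Lmodule.copy T V.

Let normD (x y : T) :
  ((hnorm form (x + y))%:C <= (hnorm form x)%:C + (hnorm form y)%:C)%R.
Proof. by rewrite -rmorphD /= lecR hnormD. Qed.

Let normZ (l : R[i]) (x : T) : (hnorm form (l *: x))%:C = `|l| * (hnorm form x)%:C.
Proof. exact: hnormZ. Qed.

Let norm_eq0 (x : T) : (hnorm form x)%:C = 0 -> x = 0.
Proof. by move=> [/hnorm_eq0]. Qed.

HB.instance Definition _ := @Lmodule_isNormed.Build R[i] T
  (fun x => (hnorm form x)%:C) normD normZ norm_eq0.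

Lemma dot_space_norm (x : T) : `|x| = (hnorm form x)%:C.
Proof. by []. Qed.

Lemma dot_space_cauchy_cvg (F : set_system T) :
  ProperFilter F -> cauchy F -> cvg F.
Proof.
move=> FF /cauchyP Fc.
have Fc' n : exists x, F (ball (x : T) (n.+1%:R^-1 : R)%:C).
  by apply: Fc; rewrite ltcR invr_gt0 ltr0n.
have [u uF] := choice Fc'.
have ball_hn (x y : T) (e : R) : ball x e%:C y <-> hnorm form ((x : V) - (y : V)) < e.
  by rewrite -ball_normE /ball_ /= dot_space_norm ltcR.
have [|l lP] := cform (u := u).
  move=> e e0; have [|N NP] := @invS_lt _ (e / 2); first by rewrite divr_gt0.
  exists N => m n Nm Nn; have [x []] := @filter_ex _ F _ _ (filterI (uF m) (uF n)).
  move=> /ball_hn xm /ball_hn xn; have := NP m Nm; have := NP n Nn.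
  have := hnorm_split form (u m) x (u n).
  rewrite (hnormBC form (x : V) (u n : V)); move=> mn nr mr.
  apply: le_lt_trans mn _; rewrite [e]splitr; apply: ltrD.
    exact: lt_trans xm mr.
  exact: lt_trans xn nr.
apply/cvg_ex; exists l; apply/cvg_ballP => e e0.
have eE : e = (complex.Re e)%:C by rewrite RRe_real // gtr0_real.
move: e0; rewrite eE ltcR; set r := complex.Re e => r0.
have [|N NP] := @invS_lt _ (r / 2); first by rewrite divr_gt0.
have [|M MP] := lP (r / 2); first by rewrite divr_gt0.
have := uF (maxn N M); apply: filterS => y /ball_hn uy; apply/ball_hn.
have := NP (maxn N M) (leq_maxl _ _); have := MP (maxn N M) (leq_maxr _ _).
have := hnorm_split form l (u (maxn N M)) y.
rewrite (hnormBC form (l : V) (u (maxn N M) : V)); move=> luy lu Nr.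
apply: le_lt_trans luy _; rewrite [r]splitr; apply: ltrD => //.
exact: lt_trans uy Nr.
Qed.

HB.instance Definition _ := Uniform_isComplete.Build T dot_space_cauchy_cvg.

(** The same inner product, over the module structure underlying the normed
    one. *)
Definition dot_space_form (x y : T) : R[i] := form x y.

Let formDl z : zmod_morphism (dot_space_form ^~ z).
Proof. by move=> x y; rewrite /dot_space_form linearBl. Qed.

Let formDr z : zmod_morphism (dot_space_form z).
Proof. by move=> x y; rewrite /dot_space_form linearBr. Qed.

Let formZl z : scalable_for *%R (dot_space_form ^~ z).
Proof. by move=> a x; rewrite /dot_space_form linearZl_LR. Qed.

Let formZr z : scalable_for (Num.conj \; *%R) (dot_space_form z).
Proof. by move=> a x; rewrite /dot_space_form linearZr_LR. Qed.

HB.instance Definition _ := @isBilinear.Build R[i] T T R[i] *%R (Num.conj \; *%R)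
  dot_space_form formDl formDr formZl formZr.

Let formC x y : dot_space_form x y = (-1) ^+ false * Num.conj (dot_space_form y x).
Proof. exact: hermC. Qed.

HB.instance Definition _ := @isHermitianSesquilinear.Build R[i] T false Num.conj
  dot_space_form formC.

Let form_gt0 x : x != 0 -> 0 < dot_space_form x x.
Proof. by move=> x0; rewrite /dot_space_form dnorm_gt0. Qed.

HB.instance Definition _ := @isDotProduct.Build R[i] T dot_space_form form_gt0.

Let form_norm (x : T) : dot_space_form x x = `|x| ^+ 2.
Proof.
by rewrite dot_space_norm /dot_space_form form_rdot -hnorm_sqr rmorphXn.
Qed.

Definition hilbert_of_dot : hilbert_space R :=
  @HilbertSpace R T dot_space_form form_norm.

End DotSpace.

Section HilbertTopology.
Variables (R : realType) (H : hilbert_space R).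
Local Notation hn := (hnorm (hil_dot H)).

Lemma hil_normE (x : H) : `|x| = (hn x)%:C.
Proof.
apply/eqP; rewrite -(@eqrXn2 _ 2) ?ler0c ?hnorm_ge0 //.
by rewrite -hil_norm form_rdot -hnorm_sqr rmorphXn.
Qed.

Lemma hil_ball (x y : H) (e : R) : ball x e%:C y <-> hn (x - y) < e.
Proof. by rewrite -ball_normE /ball_ /= hil_normE ltcR. Qed.

(** A set is closed when it contains every point that it approximates. *)
Lemma closed_hnormP (U : set H) : closed U <->
  forall x, (forall e : R, 0 < e -> exists u, U u /\ hn (x - u) < e) -> U x.
Proof.
split=> [Uc x xU|Ux x xcl].
  apply: Uc => B; rewrite -nbhs_ballE => -[e e0 eB].
  have eE : e = (complex.Re e)%:C by rewrite RRe_real // gtr0_real.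
  have [|u [Uu xu]] := xU (complex.Re e); first by rewrite -ltcR -eE.
  by exists u; split=> //; apply: eB; rewrite eE; apply/hil_ball.
apply: Ux => e e0.
have [|u [Uu /hil_ball xu]] := xcl (ball x e%:C).
  by apply: nbhsx_ballx; rewrite ltcR.
by exists u.
Qed.

Lemma hil_complete : dot_complete (hil_dot H).
Proof.
move=> u uc; have : cauchy (u @ \oo).
  apply: cauchy_exP => e e0.
  have eE : e = (complex.Re e)%:C by rewrite RRe_real // gtr0_real.
  have [|N NP] := uc (complex.Re e); first by rewrite -ltcR -eE.
  exists (u N), N => // n /= Nn.
  by rewrite eE; apply/hil_ball/NP.
move=> /cauchy_cvg/cvg_ex[l /cvg_ballP ul]; exists l => e e0.
have [|N _ NP] := ul e%:C; first by rewrite ltcR.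
by exists N => n Nn; rewrite hnormBC; apply/hil_ball; exact: NP.
Qed.

End HilbertTopology.

(** * Orthocomplemented complete lattices *)

(** [p] is an order-reversing involution satisfying the orthomodular law. That
    [x /\ p x] is the bottom is not required. *)
Definition orthocomplement (A : complete_lattice) (p : A -> A) : Prop :=
  [/\ forall x y, (x <= y)%O -> (p y <= p x)%O,
      involutive p
    & forall x y, (x <= y)%O -> (y <= cjoin x (cmeet y (p x)))%O].

Section Orthocomplement.
Variables (A : complete_lattice) (p : A -> A).
Hypothesis pO : orthocomplement p.
Implicit Types x y z : A.

Lemma perp_le x y : (p x <= p y)%O = (y <= x)%O.
Proof.
have [panti pK _] := pO.
by apply/idP/idP => [/panti|/panti//]; rewrite !pK.
Qed.

Lemma perp_join x y : p (cjoin x y) = cmeet (p x) (p y).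
Proof.
have [_ pK _] := pO; apply/eqP; rewrite eq_le le_cmeet !perp_le cjoinl cjoinr /=.
rewrite -perp_le pK cjoin_le -[x in (x <= _)%O]pK -[y in _ && (y <= _)%O]pK !perp_le.
by rewrite cmeetl cmeetr.
Qed.

Lemma perp_meet x y : p (cmeet x y) = cjoin (p x) (p y).
Proof.
by have [_ pK _] := pO; rewrite -[RHS]pK perp_join !pK.
Qed.

Lemma modular_perp a b :
  modular_pair a b <-> dual_modular_pair (p b) (p a).
Proof.
have [_ pK _] := pO; split=> [ab z az zba|ba x y xa ya xyb].
  rewrite -perp_le perp_join perp_meet !pK.
  set x := cmeet _ a; have pza : (p z <= a)%O by rewrite -perp_le pK.
  apply: le_trans (ab x (p z) (cmeetr _ _) pza (cmeetl _ _)) _.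
  by rewrite cjoin_le lexx /= -perp_le pK perp_meet cjoinC.
set t := cjoin y (cmeet a b).
have /ba : (p a <= p t)%O by rewrite perp_le cjoin_le ya cmeetl.
have tba : (p t <= cjoin (p b) (p a))%O by rewrite cjoinC -perp_meet perp_le cjoinr.
move=> /(_ tba); rewrite -perp_le perp_join perp_meet !pK; apply: le_trans.
rewrite le_cmeet xa andbT (le_trans xyb) // cjoin_le cjoinr.
by rewrite (le_trans (cjoinl y (cmeet a b))) ?cjoinl.
Qed.

Lemma normal_pair_sym :
  (forall a b : A, dual_modular_pair a b -> dual_modular_pair b a) ->
  forall a b : A, normal_pair a b -> normal_pair b a.
Proof.
move=> dsym a b [ab dab]; split; last exact: dsym.
by apply/modular_perp/dsym/modular_perp.
Qed.

(** By orthomodularity the interval above [a] is isomorphic to the interval below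
    [p a]. *)
Lemma quot_of_incl (K : complete_lattice) a (k : sup_map K A) :
  is_incl (p a) k -> exists q : sup_map A K, is_quot a q.
Proof.
move=> kp; have [panti pK oml] := pO.
have kradj y : k (radj k y) = cmeet y (p a).
  apply/eqP; rewrite eq_le le_cmeet radj_counit (incl_leq _ kp) /=.
  have [z zE] := proj1 (proj2 kp _) (cmeetr y (p a)).
  by rewrite -zE sup_map_homo // le_radj zE cmeetl.
have oml2 w : (cmeet (cjoin (k w) a) (p a) <= k w)%O.
  have := oml a (p (k w)); rewrite -[X in (X <= p (k w))%O]pK perp_le (incl_leq _ kp).
  move=> /(_ isT); rewrite -perp_le pK perp_join perp_meet !pK.
  by apply: le_trans; rewrite le_cmeet cmeetl cmeetr.
have [x w|q qE] := @sup_map_galois A K (fun x => radj k (cjoin x a))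
    (fun w => cjoin (k w) a).
  rewrite -(incl_le kp) kradj; apply/idP/idP => xw.
    apply: le_trans (cjoinl x a) _.
    apply: le_trans (oml _ _ (cjoinr x a)) _.
    by rewrite cjoin_le cjoinr (le_trans xw) ?cjoinl.
  apply: le_trans (oml2 w); rewrite le_cmeet cmeetr andbT.
  by apply: le_trans (cmeetl _ _) _; rewrite cjoin_le xw cjoinr.
have kqE x : k (q x) = cmeet (cjoin x a) (p a) by rewrite qE kradj.
exists q; split=> [w|x y].
  exists (k w); apply: (incl_inj kp); rewrite kqE; apply/eqP.
  by rewrite eq_le oml2 le_cmeet cjoinl (incl_leq _ kp).
rewrite -(incl_le kp) !kqE; apply/idP/idP => xy.
  apply: le_trans (cjoinl x a) _; apply: le_trans (oml _ _ (cjoinr x a)) _.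
  by rewrite cjoin_le cjoinr (le_trans xy) ?cmeetl.
rewrite le_cmeet cmeetr andbT; apply: le_trans (cmeetl _ _) _.
by rewrite cjoin_le xy cjoinr.
Qed.

End Orthocomplement.

(** * The lattice of closed subspaces of a Hilbert space *)

Local Notation "U '∋' x" := (csub_set U x) (at level 70).

Section ClosedSubspaces.
Variables (R : realType) (H : hilbert_space R).
Local Notation dot := (rdot (hil_dot H)).
Local Notation hn := (hnorm (hil_dot H)).
Local Notation L := (hilbert_lattice H).
Implicit Types (U V W : closed_subspace H) (x y u v : H).

Lemma csub_leP (U V : L) :
  (U <= V)%O <-> (U : closed_subspace H) `<=` (V : closed_subspace H).
Proof. by split=> /asboolP. Qed.

Lemma csub_le_mem (U V : L) x : (U <= V)%O ->
  (U : closed_subspace H) ∋ x -> (V : closed_subspace H) ∋ x.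
Proof. by move=> /csub_leP; exact. Qed.

Lemma csubZ U a x : U ∋ x -> U ∋ (a *: x).
Proof. by move=> Ux; rewrite -[_ *: _]addr0; apply: csubP => //; exact: csub0. Qed.

Lemma csubD U x y : U ∋ x -> U ∋ y -> U ∋ (x + y).
Proof. by move=> Ux Uy; rewrite -[x]scale1r; exact: csubP. Qed.

Lemma csubN U x : U ∋ x -> U ∋ (- x).
Proof. by rewrite -scaleN1r; exact: csubZ. Qed.

Lemma csubB U x y : U ∋ x -> U ∋ y -> U ∋ (x - y).
Proof. by move=> Ux Uy; apply: csubD => //; exact: csubN. Qed.

Lemma csub_approx U x :
  (forall e : R, 0 < e -> exists u, U ∋ u /\ hn (x - u) < e) -> U ∋ x.
Proof. by have /closed_hnormP := @csub_closed _ _ U; exact. Qed.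

(** A complex subspace closed under approximation underlies an element of the
    lattice of closed subspaces. *)
Lemma closed_subspace_exists (A : set H) :
  A 0 -> (forall a x y, A x -> A y -> A (a *: x + y)) ->
  (forall x, (forall e : R, 0 < e -> exists u, A u /\ hn (x - u) < e) -> A x) ->
  exists U, forall x, U ∋ x <-> A x.
Proof.
by move=> A0 AP /closed_hnormP Ac; exists (ClosedSubspace A0 AP Ac).
Qed.

Lemma le_mul_eps (a b : R) : 0 <= b -> (forall e, 0 < e -> a <= e * b) -> a <= 0.
Proof.
move=> b0 ab; apply/ler_addgt0Pr => e e0; rewrite add0r.
have b1 : 0 < b + 1 by rewrite ltr_wpDl.
have := ab (e / (b + 1)); rewrite divr_gt0 // => /(_ isT)/le_trans; apply.
by rewrite mulrAC ler_pdivrMr // ler_pM2l // lerDl.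
Qed.

(** First-order condition for the origin to be the point of the real line spanned
    by [u] nearest to [x]. *)
Lemma sqr_norm_min x u : (forall t : R, hn x <= hn (x - t%:C *: u)) ->
  dot x u = 0.
Proof.
move=> xmin.
have key t : 2 * t * dot x u <= t ^+ 2 * dot u u.
  have := xmin t; rewrite -(@ler_pXn2r _ 2) ?nnegrE ?hnorm_ge0 // !hnorm_sqr.
  rewrite !(rdotDl, rdotDr, rdotNl, rdotNr, rdotZl, rdotZr) (rdotC _ u x).
  by move=> ?; lra.
have pos (s : R) : s * s = 1 -> s * dot x u <= 0.
  move=> ss; apply: (@le_mul_eps _ (dot u u)); first exact: rdot_ge0.
  move=> e e0; have := key (e * s).
  have -> : (e * s) ^+ 2 = e * e by rewrite expr2 mulrACA ss mulr1.
  move=> k; rewrite -(ler_pM2l e0); have := rdot_ge0 (hil_dot H) u; nra.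
apply/eqP; rewrite eq_le; apply/andP; split.
  by have := pos 1; rewrite !mul1r; apply.
by have := pos (- 1); rewrite mulrNN mulr1 mulN1r oppr_le0; apply.
Qed.

Lemma halfD x : (2^-1 : R)%:C *: x + (2^-1 : R)%:C *: x = x.
Proof. by rewrite -scalerDl -rmorphD /= -[2^-1]mul1r -splitr scale1r. Qed.

Lemma hnorm_double x : hn (x + x) = 2 * hn x.
Proof.
apply/eqP; rewrite -(@eqrXn2 _ 2) ?mulr_ge0 ?hnorm_ge0 //.
by rewrite exprMn !hnorm_sqr rdotDl !rdotDr; apply/eqP; ring.
Qed.

(** The projection theorem: a minimizing sequence for the distance from [x] to [U]
    is Cauchy by the parallelogram identity, and its limit is the orthogonal
    projection of [x]. *)
Lemma projection U x : exists2 v, U ∋ v & forall u, U ∋ u -> dot (x - v) u = 0.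
Proof.
pose D := [set r | exists2 u, U ∋ u & r = hn (x - u)].
have D0 : D !=set0 by exists (hn (x - 0)), 0 => //; exact: csub0.
have Dlb : lbound D 0 by move=> _ [u _ ->]; exact: hnorm_ge0.
have Dinf : has_inf D by split=> //; exists 0.
set d := inf D.
have d0 : 0 <= d by exact: lb_le_inf.
have dle u : U ∋ u -> d <= hn (x - u).
  by move=> Uu; apply: ge_inf; [exists 0|exists u].
have seqP n : exists u, U ∋ u /\ hn (x - u) < d + n.+1%:R^-1.
  have [|_ [u Uu ->] ud] := @inf_adherent _ D n.+1%:R^-1 _ Dinf.
    by rewrite invr_gt0.
  by exists u.
have [s sP] := choice seqP.
have [|v vP] := @hil_complete _ H s.
  (* Two points of [U] at distance less than [d + t] from [x] are at squared
     distance less than [4 (d + t)^2 - 4 d^2 = t (8 d + 4 t)] from each other,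
     and this is less than [e^2]. *)
  move=> e e0; pose t := Num.min 1 (e ^+ 2 / (8 * d + 5)).
  have dd : 0 < 8 * d + 5 by rewrite ltr_wpDl // mulr_ge0.
  have t0 : 0 < t by rewrite lt_min ltr01 divr_gt0 // exprn_gt0.
  have [N NP] := invS_lt t0; exists N => m n Nm Nn.
  have [[Um xm] [Un xn]] := (sP m, sP n).
  have := parallelogram (hil_dot H) (x - s n) (x - s m).
  have -> : x - s n - (x - s m) = s m - s n by rewrite opprB addrC addrA subrK.
  have mid : 2 * d <= hn (x - s n + (x - s m)).
    have Us : U ∋ ((2^-1 : R)%:C *: (s n + s m)) by apply/csubZ/csubD.
    have -> : x - s n + (x - s m) =
        x - (2^-1 : R)%:C *: (s n + s m) + (x - (2^-1 : R)%:C *: (s n + s m)).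
      by rewrite addrACA -opprD [in RHS]addrACA -opprD halfD.
    by rewrite hnorm_double ler_pM2l // dle.
  have td : hn (x - s m) < d + t /\ hn (x - s n) < d + t.
    by split; [apply: lt_trans xm _|apply: lt_trans xn _]; rewrite ltrD2l NP.
  have [t1 te] : t <= 1 /\ t * (8 * d + 5) <= e ^+ 2.
    by split; [rewrite ge_min lexx|rewrite -ler_pdivlMr // ge_min lexx orbT].
  have [h1 h2 h3] : [/\ 0 <= hn (x - s m), 0 <= hn (x - s n) & 0 <= hn (s m - s n)].
    by rewrite !hnorm_ge0.
  rewrite -(@ltr_pXn2r _ 2) ?nnegrE ?(ltW e0) //.
  have sq_lt q : 0 <= q -> q < d + t -> q ^+ 2 < (d + t) ^+ 2.
    by move=> q0 qt; rewrite ltr_pXn2r ?nnegrE // addr_ge0 // ltW.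
  have := sq_lt _ h1 (proj1 td); have := sq_lt _ h2 (proj2 td).
  have : (2 * d) ^+ 2 <= hn (x - s n + (x - s m)) ^+ 2.
    by rewrite ler_pXn2r ?nnegrE ?mulr_ge0 ?hnorm_ge0.
  move: (hn (x - s n)) (hn (x - s m)) (hn (x - s n + (x - s m))) (hn (s m - s n)).
  by move=> q q' r p; nra.
have Uv : U ∋ v.
  apply: csub_approx => e e0.
  have [N NP] := vP e e0; exists (s N); split; first exact: (proj1 (sP N)).
  by rewrite hnormBC; exact: NP.
exists v => // u Uu; apply: sqr_norm_min => t.
have xv : hn (x - v) <= d.
  apply/ler_addgt0Pr => e e0.
  have [|N NP] := vP (e / 2); first by rewrite divr_gt0.
  have [|M MP] := @invS_lt R (e / 2); first by rewrite divr_gt0.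
  have := NP _ (leq_maxl N M); have := MP _ (leq_maxr N M).
  have := proj2 (sP (maxn N M)); have := hnorm_split (hil_dot H) x (s (maxn N M)) v.
  move: (_^-1) => r; lra.
apply: le_trans xv _; rewrite -addrA -opprD; apply: dle.
by apply: csubD => //; exact: csubZ.
Qed.

Lemma hperp_exists U : exists V, forall x, V ∋ x <-> forall u, U ∋ u -> dot x u = 0.
Proof.
apply: closed_subspace_exists => [u _|a x y Px Py u Uu|x xP u Uu].
- by rewrite rdot0l.
- by rewrite rdotDl rdot_adj Px ?Py ?addr0 //; exact: csubZ.
have bound (w : H) : U ∋ w -> dot x w <= 0.
  move=> Uw; apply: (@le_mul_eps _ (hn w)); first exact: hnorm_ge0.
  move=> e e0; have [y [Py xy]] := xP e e0.
  rewrite -[dot x w]subr0 -(Py w Uw) -rdotNl -rdotDl.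
  apply: le_trans (CauchySchwarz_real _ _ _) _.
  by rewrite ler_wpM2r ?hnorm_ge0 ?ltW.
apply/eqP; rewrite eq_le bound //=.
by have := bound (- u); rewrite rdotNr oppr_le0; apply; exact: csubN.
Qed.

(** The orthogonal complement. *)
Definition hperp U : closed_subspace H := projT1 (cid (hperp_exists U)).

Lemma hperpP U x : hperp U ∋ x <-> forall u, U ∋ u -> dot x u = 0.
Proof. by move: x; exact: projT2 (cid (hperp_exists U)). Qed.

Lemma capI_exists U V : exists W, forall x, W ∋ x <-> U ∋ x /\ V ∋ x.
Proof.
apply: (@closed_subspace_exists [set x | U ∋ x /\ V ∋ x]).
- by split; exact: csub0.
- by move=> a x y [Ux Vx] [Uy Vy]; split; exact: csubP.
- by move=> x xUV; split; apply: csub_approx => e /xUV[u [[Uu Vu] xu]]; exists u.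
Qed.

(** Meets are intersections; joins contain the algebraic sums. *)
Lemma mem_cmeet (U V : L) x :
  (cmeet U V : closed_subspace H) ∋ x <->
  (U : closed_subspace H) ∋ x /\ (V : closed_subspace H) ∋ x.
Proof.
split=> [xUV|].
  by split; move: xUV; apply: csub_le_mem; [exact: cmeetl|exact: cmeetr].
have [W WP] := capI_exists U V.
move=> /WP; apply: csub_le_mem; rewrite le_cmeet.
by apply/andP; split; apply/csub_leP => y /WP[].
Qed.

Lemma mem_cjoin (U V : L) x y :
  (U : closed_subspace H) ∋ x -> (V : closed_subspace H) ∋ y ->
  (cjoin U V : closed_subspace H) ∋ (x + y).
Proof.
move=> Ux Vy; apply: csubD.
  by move: Ux; apply: csub_le_mem; exact: cjoinl.
by move: Vy; apply: csub_le_mem; exact: cjoinr.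
Qed.

Lemma hperp_ortho : orthocomplement (hperp : L -> L).
Proof.
have le_perp2 (U : L) : (U <= hperp (hperp U) :> L)%O.
  by apply/csub_leP => x Ux; apply/hperpP => u /hperpP; rewrite rdotC; exact.
split.
- move=> U V /csub_leP UV; apply/csub_leP => x /hperpP xV; apply/hperpP => u Uu.
  exact/xV/UV.
- move=> U; apply/eqP; rewrite eq_le le_perp2 andbT; apply/csub_leP => x xU.
  have [v Uv xv] := projection U x.
  suff /rdot_eq0/eqP : dot (x - v) (x - v) = 0 by rewrite subr_eq0 => /eqP ->.
  have xvP : hperp U ∋ (x - v) by apply/hperpP.
  rewrite rdotDr rdotNr (xv v Uv) subr0 rdotC.
  by move/hperpP : xU; exact.
- move=> U V /csub_leP UV; apply/csub_leP => x Vx.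
  have [v Uv xv] := projection U x.
  rewrite -[x](subrK v) addrC; apply: mem_cjoin => //.
  by apply/mem_cmeet; split; [apply/csubB/UV|apply/hperpP].
Qed.

Lemma form_eq0 x w : (forall a : R[i], dot (a *: x) w = 0) -> hil_dot H x w = 0.
Proof.
move=> xw; apply/eqP; rewrite eq_complex /=; apply/andP; split; apply/eqP.
  by have := xw 1; rewrite scale1r.
have := xw 'i; rewrite /rdot linearZl_LR /= mulrC ReiNIm => /eqP.
by rewrite oppr_eq0 => /eqP.
Qed.

Lemma hnorm_proj x w a : hil_dot H (x - a *: w) w = 0 -> hn (x - a *: w) <= hn x.
Proof.
have : x = x - a *: w + a *: w by rewrite subrK.
move: (x - a *: w) => y -> yw; have d0 : dot y (a *: w) = 0.
  by rewrite /rdot linearZr_LR /= yw mulr0.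
rewrite -(@ler_pXn2r _ 2) ?nnegrE ?hnorm_ge0 // !hnorm_sqr.
rewrite rdotDl !rdotDr (rdotC _ (a *: w) y) d0 addr0 add0r lerDl.
exact: rdot_ge0.
Qed.

(** The sum of a closed subspace and a line is closed. *)
Lemma add_line_exists U v : exists W,
  forall x, W ∋ x <-> exists u (a : R[i]), U ∋ u /\ x = u + a *: v.
Proof.
have [p Up pv] := projection U v; set w := v - p.
have [w0|wN0] := eqVneq w 0.
  have Uv : U ∋ v by move/eqP: w0; rewrite subr_eq0 => /eqP ->.
  exists U => x; split=> [Ux|[u [a [Uu ->]]]]; last by apply/csubD/csubZ.
  by exists x, 0; rewrite scale0r addr0.
pose form := hil_dot H.
have uw u : U ∋ u -> form u w = 0.
  move=> Uu; apply: form_eq0 => a; rewrite rdotC; apply: pv; exact: csubZ.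
have ww : form w w != 0 by rewrite dnorm_eq0.
have vE : v = w + p by rewrite subrK.
clearbody w.
(* [c x] is the coefficient of the projection of [x] on the line spanned by [w],
   the component of [v] orthogonal to [U]. *)
pose c x := form x w / form w w.
apply: closed_subspace_exists.
- by exists 0, 0; rewrite scale0r addr0; split; [exact: csub0|].
- move=> a _ _ [u [b [Uu ->]]] [u' [b' [Uu' ->]]].
  exists (a *: u + u'), (a * b + b'); split; first exact: csubP.
  by rewrite scalerDr scalerA scalerDl addrACA.
- move=> x xP; have Ux : U ∋ (x - c x *: w).
    apply: csub_approx => e /xP[_ [[u [a [Uu ->]]] xu]].
    exists (u + a *: p); split; first by apply/csubD/csubZ.
    apply: le_lt_trans xu; set z := x - (u + a *: v).
    have xE : x = z + (u + a *: p) + a *: w.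
      by rewrite -addrA -[_ + a *: w]addrA -scalerDr [p + w]addrC -vE subrK.
    clearbody z.
    have cxE : c x = c z + a.
      rewrite /c [in LHS]xE !linearDl !mulrDl !linearZl_LR /=.
      by rewrite (uw u Uu) (uw p Up) mulr0 !mul0r !addr0 mulfK.
    have -> : x - c x *: w - (u + a *: p) = z - c z *: w.
      rewrite cxE {1}xE scalerDl opprD [- _ - _]addrC addrA addrK.
      by rewrite addrAC addrK.
    apply: hnorm_proj; rewrite linearBl /= linearZl_LR /= divfK // subrr.
    by [].
  exists (x - c x *: w - c x *: p), (c x); split; first by apply/csubB/csubZ.
  by rewrite vE scalerDr -[x - _ - _]addrA -opprD subrK.
Qed.

(** Dual modularity of [(U, V)] says that the closed join of [U] and [V] is their
    algebraic sum. The nontrivial direction applies it to the closed subspace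
    spanned by [V] and one vector of the join. *)
Lemma dual_modular_pairE (U V : L) : dual_modular_pair U V <->
  forall x, (cjoin U V : closed_subspace H) ∋ x ->
    exists u v, [/\ (U : closed_subspace H) ∋ u,
                     (V : closed_subspace H) ∋ v & x = u + v].
Proof.
split=> [dUV x xUV|sumUV W VW WUV]; last first.
  apply/csub_leP => x Wx.
  have [u [v [Uu Vv xE]]] := sumUV _ (csub_le_mem WUV Wx).
  rewrite xE; apply: mem_cjoin => //; apply/mem_cmeet; split=> //.
  by rewrite -(addrK v u) -xE; apply: csubB => //; exact: csub_le_mem Vv.
have [W WP] := add_line_exists V x.
have VW : (V <= W :> L)%O.
  apply/csub_leP => v Vv; apply/WP; exists v, 0.
  by rewrite scale0r addr0.
have Wx : W ∋ x.
  by apply/WP; exists 0, 1; rewrite scale1r add0r; split=> //; exact: csub0.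
have WUV : (W <= cjoin U V :> L)%O.
  apply/csub_leP => _ /WP[v [a [Vv ->]]]; apply: csubD; last exact: csubZ.
  by move: Vv; apply: csub_le_mem; exact: cjoinr.
have xWU := csub_le_mem (dUV _ VW WUV) Wx.
have [WUleV|/existsNP[y]] := pselect (forall y,
    (cmeet (W : L) U : closed_subspace H) ∋ y -> (V : closed_subspace H) ∋ y).
  exists 0, x; rewrite add0r; split=> //; first exact: csub0.
  by move: xWU; apply: csub_le_mem; rewrite cjoin_idl //; apply/csub_leP.
move=> /not_implyP[/mem_cmeet[/WP[v [a [Vv yE]]] Uy] Vy].
have aN0 : a != 0.
  by apply/eqP => a0; apply: Vy; rewrite yE a0 scale0r addr0.
exists (a^-1 *: y), (- (a^-1 *: v)); split; [exact: csubZ|exact/csubN/csubZ|].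
by rewrite -scalerBr yE addrC addKr scalerA mulVf // scale1r.
Qed.

Lemma dual_modular_pair_sym (U V : L) :
  dual_modular_pair U V -> dual_modular_pair V U.
Proof.
move=> /dual_modular_pairE sumUV; apply/dual_modular_pairE => x.
rewrite cjoinC => /sumUV[u [v [Uu Vv ->]]].
by exists v, u; rewrite addrC.
Qed.

End ClosedSubspaces.

Section Subspace.
Variables (R : realType) (H : hilbert_space R) (U : closed_subspace H).

Definition csub_pred : {pred H} := fun x => `[< U ∋ x >].

Fact csub_pred_submod : submod_closed csub_pred.
Proof.
split=> [|a x y /asboolP Ux /asboolP Uy]; apply/asboolP; first exact: csub0.
exact: csubP.
Qed.

HB.instance Definition _ :=
  GRing.isSubmodClosed.Build R[i] H csub_pred csub_pred_submod.

(** A closed subspace as a module of its own, with the restricted inner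
    product. *)
Definition csub_type : Type := {x : H | csub_pred x}.
HB.instance Definition _ := SubChoice.on csub_type.
HB.instance Definition _ := [SubChoice_isSubLmodule of csub_type by <:].

Lemma csub_valP (x : csub_type) : U ∋ val x.
Proof. by apply/asboolP; exact: (valP x). Qed.

Lemma csub_val0 : val (0 : csub_type) = 0.
Proof. exact: raddf0. Qed.

Lemma csub_valZD a (x y : csub_type) : val (a *: x + y) = a *: val x + val y.
Proof. exact: linearP. Qed.

Lemma csub_lift x : U ∋ x -> exists y : csub_type, val y = x.
Proof. by move=> /asboolP Ux; exists (exist _ x Ux). Qed.

Definition csub_form (x y : csub_type) : R[i] := hil_dot H (val x) (val y).

Let formDl z : zmod_morphism (csub_form ^~ z).
Proof. by move=> x y; rewrite /csub_form raddfB linearBl. Qed.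

Let formDr z : zmod_morphism (csub_form z).
Proof. by move=> x y; rewrite /csub_form !raddfB. Qed.

Let formZl z : scalable_for *%R (csub_form ^~ z).
Proof. by move=> a x; rewrite /csub_form linearZ linearZl_LR. Qed.

Let formZr z : scalable_for (Num.conj \; *%R) (csub_form z).
Proof. by move=> a x; rewrite /csub_form !linearZ. Qed.

HB.instance Definition _ := @isBilinear.Build R[i] csub_type csub_type R[i]
  *%R (Num.conj \; *%R) csub_form formDl formDr formZl formZr.

Let formC x y : csub_form x y = (-1) ^+ false * Num.conj (csub_form y x).
Proof. exact: hermC. Qed.

HB.instance Definition _ := @isHermitianSesquilinear.Build R[i] csub_type
  false Num.conj csub_form formC.

Let form_gt0 x : x != 0 -> 0 < csub_form x x.
Proof.
move=> x0; rewrite /csub_form dnorm_gt0; apply: contra_neq x0 => x0.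
by apply: val_inj; rewrite x0 raddf0.
Qed.

HB.instance Definition _ := @isDotProduct.Build R[i] csub_type csub_form form_gt0.

Lemma csub_hnorm (x y : csub_type) :
  hnorm csub_form (x - y) = hnorm (hil_dot H) (val x - val y).
Proof. by rewrite -(raddfB val). Qed.

Lemma csub_complete : dot_complete csub_form.
Proof.
move=> u uc; have [|l lP] := @hil_complete _ H (val \o u).
  by move=> e /uc[N NP]; exists N => m n /= Nm Nn; rewrite -csub_hnorm; exact: NP.
have [|y yl] := @csub_lift l.
  apply: csub_approx => e /lP[N NP]; exists (val (u N)).
  by rewrite hnormBC NP //; split=> //; exact: csub_valP.
exists y => e /lP[N NP]; exists N => n Nn; rewrite csub_hnorm yl; exact: NP.
Qed.

Definition csub_hilbert : hilbert_space R := hilbert_of_dot csub_complete.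

Let K := csub_hilbert.

Let K_hnorm (x y : csub_type) :
  hnorm (hil_dot K) ((x : K) - (y : K)) = hnorm (hil_dot H) (val x - val y).
Proof. exact: csub_hnorm. Qed.

Lemma csub_image_exists (W : closed_subspace K) : exists V : closed_subspace H,
  forall x, V ∋ x <-> exists2 y : csub_type, W ∋ (y : K) & val y = x.
Proof.
apply: closed_subspace_exists.
- by exists 0; [exact: (csub0 W)|rewrite raddf0].
- move=> a _ _ [x Wx <-] [y Wy <-]; exists (a *: x + y); last exact: csub_valZD.
  exact: (csubP a Wx Wy).
- move=> x xP; have [|y yx] := @csub_lift x.
    apply: csub_approx => e /xP[_ [[z _ <-] xz]]; exists (val z); split=> //.
    exact: csub_valP.
  exists y => //; apply: csub_approx => e /xP[_ [[z Wz <-] xz]].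
  by exists (z : K); split=> //; rewrite K_hnorm yx.
Qed.

Lemma csub_preimage_exists (V : closed_subspace H) :
  exists W : closed_subspace K, forall y : csub_type, W ∋ (y : K) <-> V ∋ val y.
Proof.
apply: (@closed_subspace_exists _ _ [set y : K | V ∋ val (y : csub_type)]).
- by have := csub0 V; rewrite -csub_val0.
- by move=> a x y /= Vx Vy; have := csubP a Vx Vy; rewrite -csub_valZD.
- move=> x xP; apply: csub_approx => e /xP[z [Vz xz]].
  by exists (val (z : csub_type)); rewrite -K_hnorm.
Qed.

(** The closed subspaces of [U] form the interval below [U]. *)
Lemma csub_incl_exists :
  exists k : sup_map (hilbert_lattice K) (hilbert_lattice H),
    is_incl (U : hilbert_lattice H) k.
Proof.
have [f fP] := choice csub_image_exists.
have [g gP] := choice csub_preimage_exists.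
have [W V|k kE] := @sup_map_galois (hilbert_lattice K) (hilbert_lattice H) f g.
  apply/idP/idP => /csub_leP le; apply/csub_leP => x.
    by move=> Wx; apply/gP/le/fP; exists x.
  by move=> /fP[y Wy <-]; apply/gP/le.
exists k; split=> [W W'|V].
  rewrite !kE => /csub_leP le; apply/csub_leP => x Wx.
  have /fP[y W'y /val_inj <-//] : f W' ∋ val (x : csub_type).
  by apply: le; apply/fP; exists x.
split=> [/csub_leP VU|[W <-]]; last first.
  by rewrite kE; apply/csub_leP => _ /fP[y _ <-]; exact: csub_valP.
exists (g V); rewrite kE; apply/eqP; rewrite eq_le; apply/andP.
split; apply/csub_leP => x; first by move=> /fP[y /gP Vy <-].
move=> Vx; apply/fP; have [y yx] := csub_lift (VU x Vx).
by exists y => //; apply/gP; rewrite yx.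
Qed.

End Subspace.

(** * Objects of the 2-category of Hilbert lattices *)

(** Transport of the previous results along an isomorphism of complete
    lattices. *)
Section Transport.
Variables (A B : complete_lattice) (f : A -> B) (g : B -> A).
Hypotheses (fK : cancel f g) (gK : cancel g f) (f_mono : {mono f : x y / (x <= y)%O}).

Lemma iso_galois x y : (f x <= y)%O = (x <= g y)%O.
Proof. by rewrite -{1}[y]gK f_mono. Qed.

Lemma iso_galois_sym x y : (g y <= x)%O = (y <= f x)%O.
Proof. by rewrite -{2}[y]gK f_mono. Qed.

Lemma iso_join x y : f (cjoin x y) = cjoin (f x) (f y).
Proof.
apply/eqP; rewrite eq_le cjoin_le !f_mono cjoinl cjoinr andbT.
by rewrite iso_galois cjoin_le -!iso_galois cjoinl cjoinr.
Qed.

Lemma iso_meet x y : f (cmeet x y) = cmeet (f x) (f y).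
Proof.
apply/eqP; rewrite eq_le le_cmeet !f_mono cmeetl cmeetr /=.
by rewrite -iso_galois_sym le_cmeet !iso_galois_sym cmeetl cmeetr.
Qed.

Lemma iso_dual_modular a b :
  dual_modular_pair a b <-> dual_modular_pair (f a) (f b).
Proof.
split=> [ab z bz zab|ab z bz zab].
  rewrite -[z]gK -iso_meet -iso_join f_mono; apply: ab.
    by rewrite -iso_galois.
  by rewrite -f_mono gK iso_join.
rewrite -f_mono iso_join iso_meet; apply: ab; first by rewrite f_mono.
by rewrite -iso_join f_mono.
Qed.

Lemma iso_orthocomplement (p : B -> B) :
  orthocomplement p -> orthocomplement (g \o p \o f).
Proof.
case=> panti pK oml; split=> [x y xy|x|x y xy] /=.
- by rewrite -f_mono !gK; apply: panti; rewrite f_mono.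
- by rewrite gK pK fK.
- by rewrite -f_mono iso_join iso_meet gK; apply: oml; rewrite f_mono.
Qed.

Lemma iso_incl (K : complete_lattice) a (k : sup_map K B) : is_incl (f a) k ->
  exists l : sup_map K A, is_incl a l.
Proof.
move=> ka; have [x y|l lE] := @sup_map_galois K A (g \o k) (radj k \o f).
  by rewrite /= iso_galois_sym le_radj.
exists l; split=> [x y|x]; first by rewrite !lE /= -f_mono !gK (incl_le ka).
rewrite -f_mono; split=> [/(proj2 ka)[y yx]|[y <-]].
  by exists y; rewrite lE /= yx fK.
by rewrite lE /= gK (incl_leq _ ka).
Qed.

End Transport.

Section HilbertObjects.
Variable R : realType.
Implicit Type A : SupHil R.

(** The lattice of closed subspaces of [H] as an object of the 2-category. *)
Definition hil_object (H : hilbert_space R) : SupHil R :=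
  exist _ (hilbert_lattice H)
    (ex_intro _ H (ex_intro2 _ _ id (inv_bij (fun=> erefl)) (fun _ _ => erefl))).

Lemma incl_exists A (a : sval A) :
  exists (K : SupHil R) (k : hom1 K A), is_incl a k.
Proof.
case: A a => A [H [f [g fK gK] f_mono]] /= a.
have [k ka] := csub_incl_exists (f a).
have [l la] := iso_incl fK gK f_mono ka.
by exists (hil_object (csub_hilbert (f a))), l.
Qed.

Lemma perp_exists A : exists p : sval A -> sval A, orthocomplement p.
Proof.
case: A => A [H [f [g fK gK] f_mono]] /=.
by eexists; apply: (iso_orthocomplement fK gK f_mono); exact: hperp_ortho.
Qed.

Lemma quot_exists A (a : sval A) :
  exists (Q : SupHil R) (q : hom1 A Q), is_quot a q.
Proof.
have [p pO] := perp_exists A; have [K [k kp]] := incl_exists (p a).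
have [q qa] := quot_of_incl pO kp.
by exists K, q.
Qed.

Lemma hil_normal_pair_sym A (a b : sval A) : normal_pair a b -> normal_pair b a.
Proof.
have [p pO] := perp_exists A; apply: (normal_pair_sym pO) => {}a {}b.
case: A a b {p pO} => A [H [f [g fK gK] f_mono]] /= a b.
move=> /(iso_dual_modular gK f_mono)/dual_modular_pair_sym.
by move=> /(iso_dual_modular gK f_mono).
Qed.

End HilbertObjects.

(** * Kernels, cokernels and normality in order-theoretic terms *)

Section Characterisations.
Variable R : realType.
Implicit Types A B C O : SupHil R.

(** Since hom-categories are partial orders, isomorphic 1-cells are equal. *)
Lemma iso1E A B (f g : hom1 A B) : f ≅ g <-> f = g.
Proof.
split=> [[fg [gf _]]|->]; last first.
  by exists (Defs.cid g), (Defs.cid g); split; exact: sup_cell_eq.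
apply: sup_map_ext; apply/funext => x.
have fgx : (sup_fun f x <= sup_fun g x)%O := fg x.
have gfx : (sup_fun g x <= sup_fun f x)%O := gf x.
by apply/eqP; rewrite eq_le fgx gfx.
Qed.

Lemma hom_eqP A B (f g : hom1 A B) : f =1 g :> (sval A -> sval B) <-> f = g.
Proof. by split=> [fg|->]//; apply: sup_map_ext; apply/funext. Qed.

(** If the hom-category from [O] to itself is equivalent to the terminal one, the
    identity of [O] equals the constant bottom map, hence [O] has one element. *)
Lemma bizero_trivial O : is_bizero O -> forall x y : sval O, x = y.
Proof.
move=> /(_ O)[[F [G [[eta [_ etaI]] _]]] _].
have GFE (f : hom1 O O) : G (F f) ≅ f by exists (eta f); exact: etaI.
have [z zP] := @sup_map_test (sval O) (sval O) ctop.
suff iz (x : sval O) : x = cbot by move=> x y; rewrite (iz x) (iz y).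
have : id1 O = z :> hom1 O O.
  move/iso1E : (GFE (id1 O)) => <-; move/iso1E : (GFE z) => <-.
  by congr (G _); case: (F _); case: (F _).
by move/hom_eqP => /(_ x) /= ->; rewrite zP le_ctop.
Qed.

Lemma trivial_strong_bizero O :
  (forall x y : sval O, x = y) -> is_strong_bizero O.
Proof.
move=> O1; split; last first.
  move=> A B f g [tf [sf ->]] [tg [sg ->]].
  have fg : forall x, ((sf ∘ tf) x <= (sg ∘ tg) x)%O.
    move=> x /=; rewrite (O1 (sup_fun tf x) cbot) (O1 (sup_fun tg x) cbot).
    by rewrite !sup_map_bot.
  by exists fg; split=> // ? _; exact: sup_cell_eq.
have eqv (X Y : SupHil R) : (forall f g : hom1 X Y, f = g) ->
    cat_equivalent (hom1 X Y) terminal_category.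
  move=> XY; have [z _] := @sup_map_test (sval X) (sval Y) ctop.
  pose F : functor (hom1 X Y) terminal_category :=
    @Functor (hom1 X Y) terminal_category (fun=> tt) (fun _ _ _ => tt)
      (fun=> erefl) (fun _ _ _ _ _ => erefl).
  pose G : functor terminal_category (hom1 X Y) :=
    @Functor terminal_category (hom1 X Y) (fun=> z)
      (fun _ _ _ => Defs.cid (z : hom1 X Y))
      (fun=> erefl) (fun _ _ _ _ _ => @sup_cell_eq _ _ _ _ _ _).
  exists F, G; split.
    have zf (f : hom1 X Y) : forall x, (z x <= sup_fun f x)%O by rewrite (XY f z).
    have fz (f : hom1 X Y) : forall x, (sup_fun f x <= z x)%O by rewrite (XY f z).
    exists zf; split=> [f g fg|f]; first exact: sup_cell_eq.
    by exists (fz f); split; exact: sup_cell_eq.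
  exists (fun=> tt); split=> // x; exists tt; split=> //=; by case: x.
move=> A; split; apply: eqv => f g; apply/hom_eqP => x; first exact: O1.
by rewrite (O1 x cbot) !sup_map_bot.
Qed.

Section Zero.
Variable O : SupHil R.
Hypothesis O0 : is_strong_bizero O.

Let O1 : forall x y : sval O, x = y.
Proof. by case: O0 => /bizero_trivial. Qed.

Lemma iso_zeroE A B (f : hom1 A B) : iso_zero O f <-> sup_fun f ctop = cbot.
Proof.
split=> [[z [t [s ->]] /iso1E ->]|ft].
  by rewrite /= (O1 (sup_fun t ctop) cbot) sup_map_bot.
have [t _] := @sup_map_test (sval A) (sval O) ctop.
have [s _] := @sup_map_test (sval O) (sval B) ctop.
exists ((s : hom1 O B) ∘ (t : hom1 A O)); first by exists t, s.
apply/iso1E/hom_eqP => x; rewrite /= (O1 (t x) cbot) sup_map_bot.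
by apply: le_cbot; rewrite -ft; exact: sup_map_homo (le_ctop _).
Qed.

Lemma iso_zero_all A B (f : hom1 A B) :
  iso_zero O f -> forall x, sup_fun f x = cbot.
Proof.
move=> /iso_zeroE f0 x; apply: le_cbot; rewrite -f0.
exact: sup_map_homo (le_ctop _).
Qed.

(** From left to right, the universal property is tested on the maps of
    [sup_map_elt]; dually [is_2cokernelE] uses those of [sup_map_test]. *)
Lemma is_2kernelE A B K (f : hom1 A B) (k : hom1 K A) :
  is_2kernel O f k <-> is_incl (radj f cbot) k.
Proof.
split=> [[k0 kex kuniq]|ka].
  have kle x y : (sup_fun k x <= sup_fun k y)%O -> (x <= y)%O.
    move=> kxy; have [u [u0 uE]] := @sup_map_elt (sval K) (sval K) x.
    have [v [v0 vE]] := @sup_map_elt (sval K) (sval K) y.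
    have l : forall w, (sup_fun k (u w) <= sup_fun k (v w))%O.
      move=> w; have [->|wN0] := pselect (w = cbot); first by rewrite u0 v0.
      by rewrite uE // vE.
    have [m _] := kuniq K u v l.
    have [->|xN0] := pselect (x = cbot); first exact: cbot_le.
    by have := m x; rewrite uE // vE.
  split=> // x; rewrite le_radj; split=> [fx|[y <-]]; last first.
    have -> : sup_fun f (sup_fun k y) = cbot by exact: (iso_zero_all k0 y).
    exact: cbot_le.
  have [->|xN0] := pselect (x = cbot); first by exists cbot; rewrite sup_map_bot.
  have [z [z0 zE]] := @sup_map_elt (sval A) (sval A) x.
  have [|u /iso1E uz] := kex A z.
    apply/iso_zeroE => /=; apply: le_cbot.
    have [->|tN0] := pselect (ctop = cbot :> sval A).
      by rewrite z0 sup_map_bot.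
    by rewrite zE.
  by exists (sup_fun u x); rewrite -[RHS](zE x) // -uz.
split=> [|Z z z0|Z u v l].
- apply/iso_zeroE; rewrite /= (incl_top ka).
  exact/le_cbot/radj_counit.
- have [|u uE] := @incl_factor _ _ _ _ _ z ka.
    rewrite le_radj.
    have -> : sup_fun f (sup_fun z ctop) = cbot by exact: (iso_zero_all z0 ctop).
    exact: lexx.
  by exists u; apply/iso1E/hom_eqP.
- have uv : forall x, (sup_fun u x <= sup_fun v x)%O.
    by move=> x; rewrite -(incl_le ka); exact: l.
  by exists uv; split=> [|? _]; exact: sup_cell_eq.
Qed.

Lemma is_2cokernelE A B Q (f : hom1 A B) (q : hom1 B Q) :
  is_2cokernel O f q <-> is_quot (sup_fun f ctop) q.
Proof.
set a := sup_fun f ctop; split=> [[q0 qex quniq]|qa].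
  have qa : sup_fun q a = cbot by exact: (iso_zero_all q0 ctop).
  split=> [w|x y]; last first.
    apply/idP/idP => [qxy|xya]; last first.
      apply: le_trans (sup_map_homo q xya) _.
      by rewrite sup_map_join qa cjoin_le lexx cbot_le.
    have [z zE] := @sup_map_test (sval B) (sval B) (cjoin y a).
    have [|u /iso1E uz] := qex B z.
      by apply/iso_zeroE; rewrite /= zE cjoinr.
    have : (z x <= z y)%O by rewrite -uz; exact: sup_map_homo qxy.
    rewrite !zE cjoinl; case: ifP => // /negbT + tb.
    by rewrite (le_trans (le_ctop _) (le_trans tb (cbot_le _))).
  (* [q] is onto: the tests at [w] and at [w'], the largest element of the range
     of [q] below [w], agree on the range of [q], so [w] and [w'] are equal. *)
  pose w' := sup_fun q (radj q w).
  have [u uE] := @sup_map_test (sval Q) (sval Q) w.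
  have [v vE] := @sup_map_test (sval Q) (sval Q) w'.
  have l : forall x, (v (sup_fun q x) <= u (sup_fun q x))%O.
    move=> x; rewrite uE vE; case: ifP => qxw; first exact: cbot_le.
    case: ifP => // qxw'; move/negP: qxw => [].
    by apply: sup_map_homo; rewrite le_radj.
  have [m _] := quniq Q v u l.
  exists (radj q w); apply/eqP; rewrite eq_le radj_counit /=.
  have := m w; rewrite uE vE (lexx w); case: ifP => // /negP ww tb; case: ww.
  exact: (le_trans (le_ctop _) (le_trans tb (cbot_le _))).
split=> [|Z z z0|Z u v l].
- by apply/iso_zeroE/le_cbot; rewrite /= (quot_bot _ qa).
- have [|u uE] := @quot_factor _ _ _ _ _ z qa.
    exact: (iso_zero_all z0 ctop).
  by exists u; apply/iso1E/hom_eqP.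
- have uv : forall w, (sup_fun u w <= sup_fun v w)%O.
    by move=> w; have [x <-] := proj1 qa w; exact: l.
  by exists uv; split=> [|? _]; exact: sup_cell_eq.
Qed.

Lemma normal_2monoE K A (k : hom1 K A) :
  normal_2mono O k <-> exists a, is_incl a k.
Proof.
split=> [[B [f /is_2kernelE]]|[a ka]]; first by exists (radj f cbot).
have [Q [q qa]] := quot_exists a.
by exists Q, q; apply/is_2kernelE; rewrite (quot_kernel qa).
Qed.

Lemma normal_2epiE B Q (q : hom1 B Q) :
  normal_2epi O q <-> exists a, is_quot a q.
Proof.
split=> [[A [f /is_2cokernelE]]|[a qa]]; first by exists (sup_fun f ctop).
have [K [k ka]] := incl_exists a.
by exists K, k; apply/is_2cokernelE; rewrite (incl_top ka).
Qed.

Lemma is_imageE A B I (f : hom1 A B) (m : hom1 I B) :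
  is_image O f m <-> normal_map f /\ is_incl (sup_fun f ctop) m.
Proof.
split=> [[/normal_2monoE[b mb] [e /normal_2epiE[a ea] /iso1E ->]]|[[f1 f2] mf]].
  split; last by rewrite /= (quot_top ea) (incl_top mb).
  by apply/(normal_map_comp_incl _ mb)/(quot_normal ea).
split; first by apply/normal_2monoE; exists (sup_fun f ctop).
have [e eE] := incl_factor mf (lexx _).
exists e; last by apply/iso1E/hom_eqP => x; rewrite -eE.
apply/normal_2epiE; exists (radj f cbot); split=> [w|x y].
  have [|x xw] := f2 (sup_fun m w); first exact: incl_leq mf.
  by exists x; apply: (incl_inj mf); rewrite -xw -eE.
rewrite -(incl_le mf); have := eE x; have := eE y => /= -> ->.
apply/idP/idP => [/f1//|/(sup_map_homo f)/le_trans]; apply.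
rewrite sup_map_join cjoin_le lexx /=.
exact: le_trans (radj_counit _ _) (cbot_le _).
Qed.

Lemma normal1E A B (f : hom1 A B) : normal1 O f <-> normal_map f.
Proof.
split=> [[I [m /is_imageE[]]]//|fN].
have [I [m mP]] := incl_exists (sup_fun f ctop).
by exists I, m; apply/is_imageE.
Qed.

Lemma exact2E A B C (f : hom1 A B) (g : hom1 B C) :
  exact2 O f g <-> [/\ normal_map f, normal_map g
    & radj g cbot = sup_fun f ctop].
Proof.
split=> [[/normal1E fN /normal1E gN [I [m [/is_imageE[_ mf] /is_2kernelE mg]]]]|].
  by split=> //; rewrite -(incl_top mf) (incl_top mg).
case=> fN gN fg; split; [exact/normal1E|exact/normal1E|].
have [I [m mP]] := incl_exists (sup_fun f ctop).
exists I, m; split; first exact/is_imageE.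
by apply/is_2kernelE; rewrite fg.
Qed.

End Zero.
End Characterisations.

(** * Square-summable sequences *)

Section RealSeries.
Variable R : realType.
Implicit Types u v : nat -> R.

(** Absolutely convergent real series, and their sums. *)
Definition summable u : Prop := exists M, forall n, series (fun k => `|u k|) n <= M.
Definition ssum u : R := limn (series u).

Lemma summable_cvg u : summable u -> cvgn (series u).
Proof.
move=> [M uM]; apply: normed_cvg; apply: nondecreasing_is_cvgn.
  by apply: nondecreasing_series => k _ _; exact: normr_ge0.
by exists M => _ [n _ <-]; exact: uM.
Qed.

Lemma summable_le u v : (forall k, `|u k| <= v k) ->
  (exists M, forall n, series v n <= M) -> summable u.
Proof.
move=> uv [M vM]; exists M => n; apply: le_trans (vM n).
by apply: ler_sum => k _.
Qed.

Lemma ssumD u v : summable u -> summable v ->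
  ssum (fun k => u k + v k) = ssum u + ssum v.
Proof. by move=> /summable_cvg uc /summable_cvg vc; exact: lim_seriesD. Qed.

Lemma ssumZ a u : summable u -> ssum (fun k => a * u k) = a * ssum u.
Proof. by move=> /summable_cvg uc; exact: lim_seriesZ. Qed.

Lemma ssumN u : summable u -> ssum (fun k => - u k) = - ssum u.
Proof. by move=> /summable_cvg uc; exact: lim_seriesN. Qed.

Lemma ssum_ub u n : (forall k, 0 <= u k) -> summable u -> series u n <= ssum u.
Proof.
move=> u0 /summable_cvg uc; apply: nondecreasing_cvgn_le => //.
by apply: nondecreasing_series => k _ _; exact: u0.
Qed.

Lemma ssum_le u M : (forall n, series u n <= M) -> summable u -> ssum u <= M.
Proof. by move=> uM /summable_cvg uc; apply: limr_le => //; exact: nearW. Qed.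

Lemma ssum_single u m : (forall k, k != m -> u k = 0) -> ssum u = u m.
Proof.
move=> um; apply/cvg_lim => //; apply: cvg_near_cst; exists m.+1 => // n /= mn.
rewrite seriesEnat /= (bigD1_seq m) ?mem_index_iota ?iota_uniq //= big1 ?addr0 //.
Qed.

Lemma cvg_series_term (s : nat -> nat -> R) (l : nat -> R) n :
  (forall k, s m k @[m --> \oo] --> l k) ->
  series (s m) n @[m --> \oo] --> series l n.
Proof.
move=> sl; elim: n => [|n IH].
  have -> : (fun m => series (s m) 0) = fun=> series l 0.
    by apply/funext => m; rewrite !seriesEnat /= !big_geq.
  exact: cvg_cst.
have -> : (fun m => series (s m) n.+1) = (fun m => series (s m) n + s m n).
  by apply/funext => m; rewrite !seriesEnat /= big_nat_recr.
have -> : series l n.+1 = series l n + l n by rewrite !seriesEnat /= big_nat_recr.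
exact: cvgD IH (sl n).
Qed.

Lemma real_complete u :
  (forall e : R, 0 < e -> exists N, forall m n, (N <= m)%N -> (N <= n)%N ->
    `|u m - u n| < e) -> cvgn u.
Proof.
move=> uc; apply: cauchy_cvg; apply: cauchy_exP => e e0.
have [N NP] := uc e e0; exists (u N), N => // n /= Nn.
by rewrite -ball_normE /ball_ /= NP.
Qed.

End RealSeries.

Lemma ImD (R : rcfType) (x y : R[i]) :
  complex.Im (x + y) = complex.Im x + complex.Im y.
Proof. by case: x y => u v [w t]. Qed.

Lemma ImN (R : rcfType) (x : R[i]) : complex.Im (- x) = - complex.Im x.
Proof. by case: x. Qed.

Section L2.
Variable R : realType.
Local Notation C := (R[i]^o).
Local Notation seqC := (nat -> C).
Local Notation Re := (@complex.Re R).
Local Notation Im := (@complex.Im R).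

(** The squared modulus of a complex number. *)
Definition sqC (a : R[i]) : R := Re a ^+ 2 + Im a ^+ 2.

Lemma sqC_ge0 a : 0 <= sqC a.
Proof. by rewrite addr_ge0 // sqr_ge0. Qed.

Lemma sqC_eq0 a : sqC a = 0 -> a = 0.
Proof.
case: a => a b /eqP; rewrite paddr_eq0 ?sqr_ge0 //= !sqrf_eq0.
by move=> /andP[/eqP -> /eqP ->].
Qed.

Lemma sqCM a b : sqC (a * b) = sqC a * sqC b.
Proof. by case: a b => a b [c d]; rewrite /sqC /=; ring. Qed.

Lemma sqCD a b : sqC (a + b) <= 2 * sqC a + 2 * sqC b.
Proof.
case: a b => a b [c d]; rewrite /sqC /=.
by have := sqr_ge0 (a - c); have := sqr_ge0 (b - d); nra.
Qed.

Lemma sqCN a : sqC (- a) = sqC a.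
Proof. by case: a => a b; rewrite /sqC /=; ring. Qed.

Definition square_summable : {pred seqC} :=
  fun x => `[< exists M, forall n, series (sqC \o x) n <= M >].

Fact square_summable_submod : submod_closed square_summable.
Proof.
split=> [|a x y /asboolP[M xM] /asboolP[N yN]]; apply/asboolP.
  exists 0 => n; rewrite seriesEnat /= big1 // => k _.
  by rewrite /sqC /= expr0n addr0.
exists (2 * sqC a * M + 2 * N) => n.
apply: (@le_trans _ _ (2 * sqC a * series (sqC \o x) n + 2 * series (sqC \o y) n)).
  rewrite !seriesEnat /= !big_distrr -big_split /=.
  by apply: ler_sum => k _; rewrite -mulrA -sqCM; exact: sqCD.
by apply: lerD; apply: ler_wpM2l; rewrite ?mulr_ge0 ?sqC_ge0.
Qed.

HB.instance Definition _ :=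
  GRing.isSubmodClosed.Build R[i] seqC square_summable square_summable_submod.

(** The complex vector space of square-summable sequences. *)
Definition l2 : Type := {x : seqC | square_summable x}.
HB.instance Definition _ := SubChoice.on l2.
HB.instance Definition _ := [SubChoice_isSubLmodule of l2 by <:].

Implicit Types x y z : l2.

Definition l2_coef (x : l2) (k : nat) : R[i] := val x k.

Lemma l2_coefD x y k : l2_coef (x + y) k = l2_coef x k + l2_coef y k.
Proof. by []. Qed.

Lemma l2_coefN x k : l2_coef (- x) k = - l2_coef x k.
Proof. by []. Qed.

Lemma l2_coefZ a x k : l2_coef (a *: x) k = a * l2_coef x k.
Proof. by []. Qed.

Lemma l2_coef0 k : l2_coef 0 k = 0.
Proof. by []. Qed.

Lemma l2_coef_inj (x y : l2) : (forall k, l2_coef x k = l2_coef y k) -> x = y.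
Proof. by move=> xy; apply/val_inj/funext. Qed.

(** The real and imaginary parts of the terms of the inner product. *)
Definition re_prod (x y : l2) k : R :=
  Re (l2_coef x k) * Re (l2_coef y k) + Im (l2_coef x k) * Im (l2_coef y k).
Definition im_prod (x y : l2) k : R :=
  Im (l2_coef x k) * Re (l2_coef y k) - Re (l2_coef x k) * Im (l2_coef y k).

Lemma sq_sum_bounded (x y : l2) : exists M, forall n,
  series (fun k => sqC (l2_coef x k) + sqC (l2_coef y k)) n <= M.
Proof.
have /asboolP[M xM] := valP x; have /asboolP[N yN] := valP y.
exists (M + N) => n; rewrite seriesEnat /= big_split /=.
exact: lerD (xM n) (yN n).
Qed.

Lemma re_prod_summable x y : summable (re_prod x y).
Proof.
apply: summable_le (sq_sum_bounded x y) => k; rewrite /re_prod /sqC.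
case: (l2_coef x k) (l2_coef y k) => a b [c d] /=; rewrite ler_norml.
have := (sqr_ge0 (a + c), sqr_ge0 (a - c), sqr_ge0 (b + d), sqr_ge0 (b - d)).
by move=> [[[]]] *; apply/andP; split; nra.
Qed.

Lemma im_prod_summable x y : summable (im_prod x y).
Proof.
apply: summable_le (sq_sum_bounded x y) => k; rewrite /im_prod /sqC.
case: (l2_coef x k) (l2_coef y k) => a b [c d] /=; rewrite ler_norml.
have := (sqr_ge0 (a + d), sqr_ge0 (a - d), sqr_ge0 (b + c), sqr_ge0 (b - c)).
by move=> [[[]]] *; apply/andP; split; nra.
Qed.

Definition l2_form (x y : l2) : R[i] := ssum (re_prod x y) +i* ssum (im_prod x y).

Hint Resolve re_prod_summable im_prod_summable : core.

Lemma summableZ (a : R) (u : nat -> R) : summable u -> summable (fun k => a * u k).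
Proof.
move=> [M uM]; exists (`|a| * M) => n; rewrite seriesEnat /=.
under eq_bigr do rewrite normrM; rewrite -big_distrr /=.
by apply: ler_wpM2l => //; exact: uM.
Qed.

Lemma summableN (u : nat -> R) : summable u -> summable (fun k => - u k).
Proof.
move=> [M uM]; exists M => n; rewrite seriesEnat /=.
by under eq_bigr do rewrite normrN; exact: uM.
Qed.

Lemma l2_formDl x y z : l2_form (x + y) z = l2_form x z + l2_form y z.
Proof.
rewrite /l2_form; apply/eqP; rewrite eq_complex /= -!ssumD //.
apply/andP; split; apply/eqP; congr ssum; apply/funext => k;
  rewrite /re_prod /im_prod l2_coefD;
  case: (l2_coef x k) (l2_coef y k) => a b [c d] /=; ring.
Qed.

Lemma l2_formZl a x z : l2_form (a *: x) z = a * l2_form x z.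
Proof.
case: a => a b; rewrite /l2_form; apply/eqP; rewrite eq_complex /=.
have reE : re_prod ((a +i* b) *: x) z =
    fun k => a * re_prod x z k + - (b * im_prod x z k).
  apply/funext => k; rewrite /re_prod /im_prod l2_coefZ.
  by case: (l2_coef x k) => c d /=; ring.
have imE : im_prod ((a +i* b) *: x) z =
    fun k => a * im_prod x z k + b * re_prod x z k.
  apply/funext => k; rewrite /re_prod /im_prod l2_coefZ.
  by case: (l2_coef x k) => c d /=; ring.
have [sre sim] := (re_prod_summable x z, im_prod_summable x z).
rewrite reE imE (ssumD (summableZ a sre) (summableN (summableZ b sim))).
rewrite (ssumD (summableZ a sim) (summableZ b sre)) (ssumN (summableZ b sim)).
by rewrite (ssumZ _ sre) !(ssumZ _ sim) (ssumZ _ sre) !eqxx.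
Qed.


Lemma l2_formC x y : l2_form x y = (-1) ^+ false * Num.conj (l2_form y x).
Proof.
rewrite expr0 mul1r -[RHS]/(conjc _) /l2_form /=; apply/eqP.
rewrite eq_complex /= -ssumN //.
apply/andP; split; apply/eqP; congr ssum; apply/funext => k;
  rewrite /re_prod /im_prod; ring.
Qed.


Let formDl z : zmod_morphism (l2_form ^~ z).
Proof. by move=> x y; rewrite l2_formDl -scaleN1r l2_formZl mulN1r. Qed.

Let formDr z : zmod_morphism (l2_form z).
Proof.
move=> x y; rewrite l2_formC (l2_formC z x) (l2_formC z y) (formDl z).
by rewrite rmorphB mulrBr.
Qed.

Let formZr z : scalable_for (Num.conj \; *%R) (l2_form z).
Proof.
move=> a x; rewrite l2_formC (l2_formC z x) l2_formZl.
by rewrite rmorphM !expr0 !mul1r.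
Qed.

HB.instance Definition _ := @isBilinear.Build R[i] l2 l2 R[i] *%R (Num.conj \; *%R)
  l2_form formDl formDr (fun z a x => l2_formZl a x z) formZr.

HB.instance Definition _ := @isHermitianSesquilinear.Build R[i] l2 false Num.conj
  l2_form l2_formC.

Lemma re_prod_diag x : re_prod x x = sqC \o l2_coef x.
Proof. by apply/funext => k; rewrite /re_prod /= /sqC !expr2. Qed.

Lemma sqC_coef_le x k : sqC (l2_coef x k) <= ssum (re_prod x x).
Proof.
have xx := re_prod_summable x x; rewrite re_prod_diag in xx *.
apply: le_trans (ssum_ub k.+1 (fun k => sqC_ge0 (l2_coef x k)) xx).
rewrite seriesEnat /= big_nat_recr //= lerDr.
by apply: sumr_ge0 => j _; exact: sqC_ge0.
Qed.

Lemma l2_form_diag x : l2_form x x = (ssum (re_prod x x))%:C.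
Proof.
congr Complex; rewrite (@ssum_single _ _ 0%N) /im_prod; first by ring.
by move=> k _; ring.
Qed.

Let form_gt0 x : x != 0 -> 0 < l2_form x x.
Proof.
move=> xN0; rewrite l2_form_diag ltcR lt0r; apply/andP; split; last first.
  exact: le_trans (sqC_ge0 _) (sqC_coef_le x 0).
apply: contra_neq xN0 => x0; apply: l2_coef_inj => k.
apply/sqC_eq0/eqP; rewrite eq_le sqC_ge0 andbT -x0; exact: sqC_coef_le.
Qed.

HB.instance Definition _ := @isDotProduct.Build R[i] l2 l2_form form_gt0.

Lemma l2_hnorm_sqr x : hnorm l2_form x ^+ 2 = ssum (sqC \o l2_coef x).
Proof. by rewrite hnorm_sqr /rdot /= re_prod_diag. Qed.

Lemma l2_hnorm_coef x k : sqC (l2_coef x k) <= hnorm l2_form x ^+ 2.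
Proof. by rewrite hnorm_sqr; exact: sqC_coef_le. Qed.

Lemma l2_exists (f : nat -> R[i]) :
  (exists M, forall n, series (sqC \o f) n <= M) ->
  exists x : l2, l2_coef x = f.
Proof. by move=> /asboolP fP; exists (exist _ (f : seqC) fP). Qed.

(** The limit of a Cauchy sequence is taken coefficientwise; the partial sums of
    the squared distance to it are bounded by passing to the limit in the Cauchy
    condition. *)
Lemma l2_complete : dot_complete l2_form.
Proof.
move=> u uc.
have lim_exists (p : R[i] -> R) : (forall a, p a ^+ 2 <= sqC a) ->
    (forall a b, p (a - b) = p a - p b) ->
    forall k, cvgn (fun n => p (l2_coef (u n) k)).
  move=> psq pB k; apply: real_complete => e /uc[N NP].
  exists N => m n Nm Nn; apply: le_lt_trans (NP m n Nm Nn).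
  rewrite -pB -l2_coefN -l2_coefD.
  rewrite -(@ler_pXn2r _ 2) ?nnegrE ?hnorm_ge0 // real_normK ?num_real //.
  exact: le_trans (psq _) (l2_hnorm_coef _ _).
have re_cvg : forall k, cvgn (fun n => Re (l2_coef (u n) k)).
  apply: lim_exists => [a|[a b] [c d]//]; by rewrite lerDl sqr_ge0.
have im_cvg : forall k, cvgn (fun n => Im (l2_coef (u n) k)).
  apply: lim_exists => [a|[a b] [c d]//]; by rewrite lerDr sqr_ge0.
pose f k := limn (fun n => Re (l2_coef (u n) k)) +i*
            limn (fun n => Im (l2_coef (u n) k)).
have tail e : 0 < e -> exists N, forall n, (N <= n)%N -> forall K,
    series (fun k => sqC (l2_coef (u n) k - f k)) K <= e ^+ 2.
  move=> e0; have [N NP] := uc e e0; exists N => n Nn K.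
  have cvgK : (fun m => series (fun k => sqC (l2_coef (u n) k - l2_coef (u m) k)) K)
      @ \oo --> series (fun k => sqC (l2_coef (u n) k - f k)) K.
    apply: cvg_series_term => k; rewrite /sqC !(ReD, ReN, ImD, ImN) !expr2.
    under eq_fun do rewrite !(ReD, ReN, ImD, ImN) !expr2.
    have re_diff : Re (l2_coef (u n) k) - Re (l2_coef (u m) k) @[m --> \oo] -->
        Re (l2_coef (u n) k) - Re (f k) by apply: cvgB (re_cvg k); exact: cvg_cst.
    have im_diff : Im (l2_coef (u n) k) - Im (l2_coef (u m) k) @[m --> \oo] -->
        Im (l2_coef (u n) k) - Im (f k) by apply: cvgB (im_cvg k); exact: cvg_cst.
    by apply: cvgD; apply: cvgM.
  rewrite -(cvg_lim _ cvgK) //; apply: limr_le; first exact: cvgP cvgK.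
  exists N => // m /= Nm; apply: (@le_trans _ _ (hnorm l2_form (u n - u m) ^+ 2)).
    rewrite l2_hnorm_sqr -re_prod_diag.
    have -> : (fun k => sqC (l2_coef (u n) k - l2_coef (u m) k)) =
        re_prod (u n - u m) (u n - u m) by rewrite re_prod_diag.
    apply: (ssum_ub K _ (re_prod_summable (u n - u m) (u n - u m))) => k.
    by rewrite re_prod_diag; exact: sqC_ge0.
  by rewrite ler_pXn2r ?nnegrE ?hnorm_ge0 ?(ltW e0) //; apply/ltW/NP.
(* The limit is [u N0 - y], where [y] is the square-summable difference between
   [u N0] and the coefficientwise limit [f]. *)
have [N0 N0P] := tail 1 ltr01.
have [y yE] : exists y, l2_coef y = (fun k => l2_coef (u N0) k - f k).
  by apply: l2_exists; exists (1 ^+ 2) => n; exact: N0P.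
exists (u N0 - y) => e e0.
have [|N NP] := tail (e / 2); first by rewrite divr_gt0.
exists N => n Nn; rewrite -(@ltr_pXn2r _ 2) ?nnegrE ?hnorm_ge0 ?(ltW e0) //.
rewrite l2_hnorm_sqr -re_prod_diag.
apply: (@le_lt_trans _ _ ((e / 2) ^+ 2)).
  apply: ssum_le => // M; rewrite re_prod_diag; apply: le_trans (NP n Nn M).
  apply: ler_sum => k _ /=.
  have -> : l2_coef (u n - (u N0 - y)) k = l2_coef (u n) k - f k; last exact: lexx.
  by rewrite !(l2_coefD, l2_coefN) yE; ring.
by rewrite ltr_pXn2r ?nnegrE ?divr_ge0 ?ltW // ltr_pdivrMr // ltr_pMr // ltr1n.
Qed.

End L2.

(** * Closed subspaces whose sum is not closed *)

Section Counterexample.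
Variable R : realType.
Local Notation Re := (@complex.Re R).
Local Notation Im := (@complex.Im R).
Local Notation l2 := (l2 R).
Local Notation l2_form := (@l2_form R).

Definition l2_hilbert : hilbert_space R := hilbert_of_dot (@l2_complete R).
Local Notation H := l2_hilbert.

(** The sequences whose odd coefficients are prescribed multiples, by numbers of
    modulus at most 1, of the preceding even coefficients form a closed
    subspace. *)
Lemma graph_exists (c : nat -> R[i]) : (forall k, sqC (c k) <= 1) ->
  exists U : closed_subspace H, forall x : l2, U ∋ (x : H) <->
    forall k, odd k -> l2_coef x k = c k * l2_coef x k.-1.
Proof.
move=> c1; pose A := [set x : H | forall k, odd k ->
  l2_coef (x : l2) k = c k * l2_coef (x : l2) k.-1].
apply: (@closed_subspace_exists _ H A).
- by move=> k _; rewrite !l2_coef0 mulr0.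
- move=> a x y Ax Ay k ok; rewrite !l2_coefD !l2_coefZ (Ax k ok) (Ay k ok).
  by ring.
move=> x xA k ok; apply/eqP; rewrite -subr_eq0; apply/eqP/sqC_eq0/eqP.
rewrite eq_le sqC_ge0 andbT; apply/ler_addgt0Pr => e e0; rewrite add0r.
have [|y [Ay xy]] := xA (Num.sqrt (e / 4)); first by rewrite sqrtr_gt0 divr_gt0.
have xy2 : hnorm l2_form ((x : l2) - (y : l2)) ^+ 2 <= e / 4.
  have e4 : 0 <= e / 4 by rewrite divr_ge0 // ltW.
  rewrite -(sqr_sqrtr e4) ler_pXn2r ?nnegrE ?hnorm_ge0 ?sqrtr_ge0 //.
  exact: ltW.
have h1 := l2_hnorm_coef ((x : l2) - (y : l2)) k.
have h2 := l2_hnorm_coef ((x : l2) - (y : l2)) k.-1.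
have -> : l2_coef x k - c k * l2_coef x k.-1 =
    l2_coef ((x : l2) - (y : l2)) k +
    - (c k * l2_coef ((x : l2) - (y : l2)) k.-1).
  by rewrite !l2_coefD !l2_coefN (Ay k ok); ring.
apply: le_trans (sqCD _ _) _; rewrite sqCN sqCM.
have h3 : sqC (c k) * sqC (l2_coef ((x : l2) - (y : l2)) k.-1) <= e / 4.
  by rewrite -[leRHS]mul1r ler_pM ?sqC_ge0 // (le_trans h2).
by have h4 := le_trans h1 xy2; lra.
Qed.

Lemma single_exists k (z : R[i]) : exists x : l2,
  l2_coef x = fun j => if j == k then z else 0.
Proof.
apply: l2_exists; exists (sqC z) => n.
have off j : j != k -> sqC (if j == k then z else 0) = 0.
  by move=> /negPf ->; rewrite /sqC /= expr0n addr0.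
rewrite seriesEnat /=; have [kn|nk] := ltnP k n.
  by rewrite (bigD1_seq k) ?mem_index_iota ?iota_uniq //= eqxx big1 ?addr0 //.
rewrite big_nat big1; first exact: sqC_ge0.
move=> j /andP[_ jn]; apply: off.
by apply: contraTneq jn => ->; rewrite -leqNgt.
Qed.

Lemma rdot_single (w x : l2) k z : l2_coef x = (fun j => if j == k then z else 0) ->
  rdot l2_form w x = Re (l2_coef w k) * Re z + Im (l2_coef w k) * Im z.
Proof.
move=> xE; rewrite /rdot /= (@ssum_single _ _ k) /re_prod xE; first by rewrite eqxx.
by move=> j /negPf ->; rewrite /= !mulr0 addr0.
Qed.

(** [U] consists of the sequences vanishing at odd indices, [V] is the graph with
    [c k = 2^-k]. No nonzero vector is orthogonal to both, so their closed join is
    the whole space; but the sequence [v] equal to [2^-k] at odd [k] and to 0 at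
    even [k] is not a sum, since its component in [V] would be 1 at every even
    index. *)
Lemma non_dual_modular : exists U V : hilbert_lattice H, ~ dual_modular_pair U V.
Proof.
pose r : R := 2^-1; have r0 : 0 < r by rewrite invr_gt0.
have r1 : r <= 1 by rewrite invf_le1 // ler1n.
pose c k : R[i] := (r ^+ k)%:C.
have c1 k : sqC (c k) <= r ^+ k.
  rewrite /sqC /= [0 ^+ 2]expr0n addr0 expr2 ger_pMr ?exprn_gt0 //.
  by rewrite exprn_ile1 // ltW.
have c_le1 k : sqC (c k) <= 1.
  by apply: le_trans (c1 k) _; rewrite exprn_ile1 // ltW.
have [|U UP] := @graph_exists (fun=> 0).
  by move=> k; rewrite /sqC /= expr0n addr0 ler01.
have [V VP] := graph_exists c_le1.
exists U, V => /dual_modular_pairE sumUV.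
have join_all (x : H) : (cjoin (U : hilbert_lattice H) V : closed_subspace H) ∋ x.
  have [_ pK _] := hperp_ortho H; rewrite -[cjoin _ _]pK.
  rewrite (perp_join (hperp_ortho H)); apply/hperpP => w /mem_cmeet[wU wV].
  have even0 k : ~~ odd k -> l2_coef (w : l2) k = 0.
    move=> ek; have [e eE] := single_exists k (l2_coef (w : l2) k).
    have Ue : U ∋ (e : H).
      apply/UP => j oj; rewrite mul0r eE; case: eqP => // jk.
      by move: ek; rewrite -jk oj.
    have : rdot l2_form w e = 0 by move/hperpP : wU; apply.
    by rewrite (rdot_single w eE) => /sqC_eq0.
  have w0 k : l2_coef (w : l2) k = 0.
    case: k => [|k]; first exact: even0.
    have [ok|/even0//] := boolP (odd k.+1); have ek : ~~ odd k by [].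
    have [e eE] := single_exists k.+1 (c k.+1 * l2_coef (w : l2) k.+1).
    have [e' e'E] := single_exists k (l2_coef (w : l2) k.+1).
    have Ve : V ∋ ((e : H) + (e' : H)).
      apply/VP => -[//|j] oj; rewrite !l2_coefD eE e'E eqSS /=.
      have -> : (j.+1 == k) = false by apply: contraNF ek => /eqP <-.
      have -> : (j == k.+1) = false by apply: contraNF oj => /eqP ->; rewrite /= ek.
      by case: eqP => [->|_]; rewrite ?addr0 ?add0r ?mulr0.
    have : rdot l2_form w (e + e') = 0 by move/hperpP : wV; apply.
    rewrite rdotDr (rdot_single w eE) (rdot_single w e'E) (even0 k ek) => wk.
    have {wk} : r ^+ k.+1 * sqC (l2_coef (w : l2) k.+1) = 0.
      rewrite -wk /c /sqC; case: (l2_coef _ _) => p q /=; ring.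
    by move=> /eqP; rewrite mulf_eq0 expf_eq0 (gt_eqF r0) andbF => /eqP/sqC_eq0.
  have -> : w = 0 by apply: (@l2_coef_inj _ (w : l2) 0) => k; rewrite w0.
  by rewrite rdotC rdot0l.
have [v vE] : exists v : l2, l2_coef v = fun k => if odd k then c k else 0.
  apply: l2_exists; exists 2 => n.
  suff : series (@sqC R \o (fun k => if odd k then c k else 0)) n <= 2 - 2 * r ^+ n.
    by move=> /le_trans; apply; rewrite gerBl mulr_ge0 // exprn_ge0 // ltW.
  elim: n => [|n IH]; first by rewrite seriesEnat /= big_geq // expr0 mulr1 subrr.
  have -> (f : nat -> R) : series f n.+1 = series f n + f n.
    by rewrite !seriesEnat /= big_nat_recr.
  have vn : sqC (if odd n then c n else 0) <= r ^+ n.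
    by case: ifP => _ //; rewrite /sqC /= expr0n addr0 exprn_ge0 // ltW.
  have r2 : 2 * r ^+ n.+1 = r ^+ n by rewrite exprS mulrA mulfV ?mul1r // pnatr_eq0.
  rewrite r2; apply: le_trans (lerD IH vn) _; lra.
have [u [w [/UP Uu /VP Vw vuw]]] := sumUV v (join_all v).
have w1 k : ~~ odd k -> l2_coef (w : l2) k = 1.
  move=> ek; have ok : odd k.+1 by rewrite /= ek.
  have : l2_coef v k.+1 = l2_coef ((u : l2) + (w : l2)) k.+1 by congr l2_coef.
  rewrite l2_coefD (Uu _ ok) (Vw _ ok) vE ok mul0r add0r /= => cc.
  have cN0 : c k.+1 != 0.
    by apply/eqP => -[/eqP]; rewrite expf_eq0 (gt_eqF r0) andbF.
  by apply: (mulfI cN0); rewrite -cc mulr1.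
have /asboolP[M MP] := valP (w : l2).
have wn n : n%:R <= series (@sqC R \o l2_coef (w : l2)) n.*2.
  elim: n => [|n IH]; first by rewrite seriesEnat /= big_geq.
  rewrite doubleS; have -> (f : nat -> R) m : series f m.+2 = series f m + f m + f m.+1.
    by rewrite !seriesEnat /= !big_nat_recr.
  rewrite -addrA -natr1; apply: lerD => //=.
  rewrite w1 ?odd_double // {1}/sqC /= expr1n expr0n addr0 lerDl; exact: sqC_ge0.
have [n Mn] : exists n : nat, M < n%:R.
  exists (Num.bound `|M|); apply: le_lt_trans (ler_norm M) _.
  exact: archi_boundP (normr_ge0 M).
by have := lt_le_trans Mn (le_trans (wn n) (MP n.*2)); rewrite ltxx.
Qed.

End Counterexample.

(** * The 2-category of Hilbert lattices *)

Section MainTheorem.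
Variable R : realType.

Lemma SupHil_2z_exact : exists O : SupHil R, is_2z_exact O.
Proof.
pose A := hil_object (@l2_hilbert R).
have [O [k k0]] := incl_exists (cbot : sval A).
exists O.
have Oz : is_strong_bizero O.
  apply: trivial_strong_bizero => x y; apply: (incl_inj k0); apply/eqP.
  by rewrite eq_le !(le_trans (incl_leq _ k0)) ?cbot_le.
split=> // X Y f.
  have [K [m mP]] := incl_exists (radj f cbot).
  by exists K, m; apply/(is_2kernelE Oz).
have [Q [q qP]] := quot_exists (sup_fun f ctop).
by exists Q, q; apply/(is_2cokernelE Oz).
Qed.

Lemma SupHil_not_2di_exact : ~ exists O : SupHil R, is_2di_exact O.
Proof.
case=> O [[O0 _ _] di]; have [U [V]] := @non_dual_modular R; apply.
pose A := hil_object (@l2_hilbert R).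
have [K [k kU]] := incl_exists (U : sval A).
have [Q [q qV]] := quot_exists (V : sval A).
have /(normal1E O0) : normal1 O (q ∘ k).
  apply: di; exists A, k, q; split.
  - by apply/(normal_2monoE O0); exists U.
  - by apply/(normal_2epiE O0); exists V.
  - exact/iso1E.
move=> /(normal_comp (incl_normal kU) (quot_normal qV)).
by rewrite (incl_top kU) (quot_kernel qV) => -[].
Qed.

End MainTheorem.

Theorem theorem9p32 (R : realType) :
  [/\ exists O : SupHil R, is_2z_exact O,
      forall O : SupHil R, is_strong_bizero O ->
        [/\ forall (A B C : SupHil R) (m' : hom1 B C) (m : hom1 A B),
              normal_2mono O m' -> normal_2mono O m ->
              normal_2mono O (m' ∘ m),
            forall (A B C : SupHil R) (e' : hom1 B C) (e : hom1 A B),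
              normal_2epi O e' -> normal_2epi O e -> normal_2epi O (e' ∘ e)
          & DPN O],
      ~ (exists O : SupHil R, is_2di_exact O)
    & forall O : SupHil R, is_strong_bizero O ->
      forall (A B C X Y Z : SupHil R)
        (a : hom1 A B) (b : hom1 B C) (t : hom1 C O)
        (s : hom1 O X) (c : hom1 X Y) (d : hom1 Y Z)
        (f : hom1 A X) (g : hom1 B Y) (h : hom1 C Z),
      g ∘ a ≅ c ∘ f -> h ∘ b ≅ d ∘ g ->
      exact2 O a b -> exact2 O b t ->
      exact2 O s c -> exact2 O c d ->
      normal1 O f -> normal1 O g -> normal1 O h ->
      forall (Kf Kg Kh Qf Qg Qh : SupHil R)
        (kf : hom1 Kf A) (kg : hom1 Kg B) (kh : hom1 Kh C)
        (qf : hom1 X Qf) (qg : hom1 Y Qg) (qh : hom1 Z Qh),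
      is_2kernel O f kf -> is_2kernel O g kg -> is_2kernel O h kh ->
      is_2cokernel O f qf -> is_2cokernel O g qg -> is_2cokernel O h qh ->
      forall (a' : hom1 Kf Kg) (b' : hom1 Kg Kh)
        (c' : hom1 Qf Qg) (d' : hom1 Qg Qh),
      kg ∘ a' ≅ a ∘ kf -> kh ∘ b' ≅ b ∘ kg ->
      c' ∘ qf ≅ qg ∘ c -> d' ∘ qg ≅ qh ∘ d ->
      [/\ exists del : hom1 Kh Qf,
            [/\ exact2 O a' b', exact2 O b' del,
                exact2 O del c' & exact2 O c' d'],
          is_2kernel O b a -> is_2kernel O b' a'
        & is_2cokernel O c d -> is_2cokernel O c' d']].
Proof.
split; [exact: SupHil_2z_exact| |exact: SupHil_not_2di_exact|].
  move=> O O0; split=> [A B C m' m|A B C e' e|K X Q m e].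
  - move=> /(normal_2monoE O0)[b m'b].
    move=> /(normal_2monoE O0)[a ma].
    by apply/(normal_2monoE O0); eexists; exact: incl_comp ma m'b.
  - move=> /(normal_2epiE O0)[b e'b].
    move=> /(normal_2epiE O0)[a ea].
    by apply/(normal_2epiE O0); eexists; exact: quot_comp ea e'b.
  - move=> /(normal_2monoE O0)[a ma].
    move=> /(normal_2epiE O0)[b eb] Ke k Cm q.
    move=> /(is_2kernelE O0) kP /(is_2cokernelE O0) qP.
    rewrite (quot_kernel eb) in kP; rewrite (incl_top ma) in qP.
    have em := normal_comp (incl_normal ma) (quot_normal eb).
    have qk := normal_comp (incl_normal kP) (quot_normal qP).
    rewrite (incl_top ma) (quot_kernel eb) in em.
    rewrite (incl_top kP) (quot_kernel qP) in qk.
    split=> /(normal1E O0) N.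
      apply/(normal1E O0)/qk.
      exact/hil_normal_pair_sym/em.
    apply/(normal1E O0)/em.
    exact/hil_normal_pair_sym/qk.
move=> O O0 A B C X Y Z a b t s c d f g h /iso1E/hom_eqP gaE /iso1E/hom_eqP hbE.
have eP := exact2E O0.
have nP := normal1E O0.
have O1 := bizero_trivial (proj1 O0).
move=> /eP[aN bN kerb] /eP[_ _ kert] /eP[_ cN kerc] /eP[_ dN kerd].
move=> /nP fN /nP gN /nP hN Kf Kg Kh Qf Qg Qh kf kg kh qf qg qh.
move=> /(is_2kernelE O0) kfI /(is_2kernelE O0) kgI /(is_2kernelE O0) khI.
move=> /(is_2cokernelE O0) qfQ /(is_2cokernelE O0) qgQ /(is_2cokernelE O0) qhQ.
move=> a' b' c' d' /iso1E/hom_eqP aE /iso1E/hom_eqP bE.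
move=> /iso1E/hom_eqP cE /iso1E/hom_eqP dE.
have b_top : sup_fun b ctop = ctop.
  rewrite -kert; apply/eqP; rewrite eq_le le_ctop le_radj.
  by rewrite (O1 (sup_fun t ctop) cbot) lexx.
have c_ker : radj c cbot = cbot.
  by rewrite kerc (O1 ctop cbot) sup_map_bot.
have symB := @hil_normal_pair_sym R B; have symY := @hil_normal_pair_sym R Y.
have [[del [[a'N b'N delN c'N d'N] kerb' kerdel kerc' kerd']] kerP cokerP] :=
  snake_lemma gaE hbE aN bN cN dN fN gN hN kerb b_top c_ker kerd symB symY
    kfI kgI khI qfQ qgQ qhQ aE bE cE dE.
split=> [|/(is_2kernelE O0) aI|/(is_2cokernelE O0) dQ].
- by exists (del : hom1 Kh Qf); split; apply/eP.
- apply/(is_2kernelE O0)/kerP/(incl_bot aI).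
  exact/le_cbot/radj_counit.
- exact/(is_2cokernelE O0)/cokerP/(quot_top dQ).
Qed.
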